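(* Suppose that $X$ is a cubical subset of $[0,1]^n$ with $\mathrm{Vol}(X) \in (0,\frac12]$. Then there is a special cubical subset $X^* \subset [0,1]^n$ with $\mathrm{Vol}(X^* ) = \mathrm{Vol}(X)$ such that \[ \mathrm{RelPer}(X^* ) \leq \mathrm{RelPer}(X). \]
   Context: $[0,1]^n \subset \mathbb{R}^n$ carries the Euclidean metric, and $e_1,\dots,e_n$ is the standard basis of $\mathbb{R}^n$. A compact subset $X \subset [0,1]^n$ is called cubical if its boundary is contained in the union of finitely many hyperplanes, all of whose outer normal vectors lie in $\{\pm e_1,\dots,\pm e_n\}$. $\mathrm{Vol}$ is $n$-dimensional Lebesgue measure. For a measurable set $U \subset [0,1]^n$ of locally finite perimeter, the relative perimeter $\mathrm{RelPer}(U)$ is the $(n-1)$-dimensional Hausdorff measure of the part of the essential boundary of $U$ that does not lie on $\partial [0,1]^n$. For $s\in[0,1]$ and $i\in\{1,\dots,n\}$ let $H_s^i = \{\sum_j x_j e_j \in \mathbb{R}^n : x_i = s\}$. The slice of a cubical set $X$ with respect to $i$ and $s$ is $X_s^i = \partial X \cap H_s^i$; $s$ is a singular point of $X$ with respect to $e_i$ (or $i$) if $X_s^i$ has Hausdorff dimension $n-1$. Steiner symmetrization: for a cubical subset $X$, $i \in \{1,\dots,n\}$ and $y \in H_0^i \cap [0,1]^n$, let $f(y)$ be the ($1$-dimensional) measure of $\ell \cap X$, where $\ell$ is the line through $y$ with direction $e_i$; let $I(y) = [0,f(y)]$ if $f(y)\neq 0$ and $I(y)=\varnothing$ if $f(y)=0$.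 Then $S_{e_i}(X) = \bigcup_{y \in H_0^i\cap[0,1]^n}\{y + t e_i : t \in I(y)\}$. A cubical subset $X$ is symmetrized if $S_{e_i}(X) = X$ for every $i\in\{1,\dots,n\}$. A cubical subset $X \subset [0,1]^n$ of volume $V \in (0,\frac12]$ is special if: (1) $X$ is symmetrized; (2) there is an open cube $C \subset \mathbb{R}^n$ centered at the origin such that $C \cap X = C \cap [0,1]^n$; (3) for every $i\in\{1,\dots,n\}$ there is at most one singular point of $X$ with respect to $i$ in $(0,1)$. *)

(* Defs.v *)
From HB Require Import structures.
From mathcomp Require Import all_boot all_order all_algebra.
From mathcomp Require Import all_classical all_reals all_analysis.

Set Implicit Arguments.
Unset Strict Implicit.
Unset Printing Implicit Defensive.

Import Order.TTheory GRing.Theory Num.Theory.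
Import numFieldNormedType.Exports.

Local Open Scope classical_set_scope.
Local Open Scope ring_scope.

(* R^n is 'rV[R]_n.  The library topology on it is the product topology, which
   is the Euclidean one; the library norm is the sup norm, so the Euclidean
   norm is defined separately below. *)

Section lebesgue_measure_Rn.
Context (R : realType).

Definition tcons n (p : measurableTypeR R * n.-tuple (measurableTypeR R)) :
  n.+1.-tuple (measurableTypeR R) := [tuple of p.1 :: p.2].

Lemma measurable_tcons n : measurable_fun [set: _] (@tcons n).
Proof. exact: (measurable_cons measurable_fst measurable_snd). Qed.

Section step.
Context (n : nat)
  (mu : {sigma_finite_measure set (n.-tuple (measurableTypeR R)) -> \bar R}).

Definition lebesgue_step : set (n.+1.-tuple (measurableTypeR R)) -> \bar R :=
  pushforward (@lebesgue_measure R \x mu)%E (@tcons n).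

Let step_measure : {measure set _ -> \bar R} :=
  measure_function_pushforward__canonical__measure_function_Measure
    (@lebesgue_measure R \x mu)%E (@measurable_tcons n).

HB.instance Definition _ := isMeasure.Build _ _ _ lebesgue_step
  (@measure0 _ _ _ step_measure) (@measure_ge0 _ _ _ step_measure)
  (@measure_semi_sigma_additive _ _ _ step_measure).

Let lebesgue_step_sigma_finite : sigma_finite setT lebesgue_step.
Proof.
have /sigma_finiteP[F [FT ndF Foo]] := sigma_finiteT (@lebesgue_measure R).
have /sigma_finiteP[G [GT ndG Goo]] := sigma_finiteT mu.
pose g (t : n.+1.-tuple (measurableTypeR R)) :
  measurableTypeR R * n.-tuple (measurableTypeR R) :=
  (thead t, [tuple of behead t]).
have mg : measurable_fun [set: _] g.
  apply/measurable_fun_pair => /=; first exact: measurable_tnth.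
  exact: measurable_behead.
exists (fun k => g @^-1` (F k `*` G k)).
  rewrite -preimage_bigcup -[LHS](preimage_setT g); congr (_ @^-1` _).
  apply/esym/seteqP; split => // -[x y] _.
  have [k _ Fkx] : (\bigcup_k F k) x by rewrite -FT.
  have [l _ Gly] : (\bigcup_k G k) y by rewrite -GT.
  exists (maxn k l) => //; split.
    by move: Fkx => /=; exact/subsetPset/ndF/leq_maxl.
  by move: Gly => /=; exact/subsetPset/ndG/leq_maxr.
move=> k; have [mFk Fkoo] := Foo k; have [mGk Gkoo] := Goo k; split.
  by rewrite -[X in measurable X]setTI; apply: mg => //; exact: measurableX.
rewrite /lebesgue_step /pushforward -comp_preimage.
have -> : g \o @tcons n = id.
  by apply/funext => -[x t]; congr (_, _); exact: val_inj.
rewrite preimage_id product_measure1E//.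
by rewrite lte_mul_pinfty// ge0_fin_numE.
Qed.

HB.instance Definition _ := Measure_isSigmaFinite.Build _ _ _
  lebesgue_step lebesgue_step_sigma_finite.

End step.

(* The n-fold product of the Lebesgue measure of R, on the product
   sigma-algebra of n.-tuple R. *)
Fixpoint lebesgue_tuple n :
    {sigma_finite_measure set (n.-tuple (measurableTypeR R)) -> \bar R} :=
  match n with
  | 0 => \d_([tuple] : 0.-tuple (measurableTypeR R))
  | m.+1 => lebesgue_step (lebesgue_tuple m)
  end.

End lebesgue_measure_Rn.

Section definitions.
Context (R : realType).

(* Meaningful for Borel A (the product sigma-algebra is not completed). *)
Definition Vol n (A : set 'rV[R]_n) : \bar R :=
  lebesgue_tuple R n [set t | A (\row_i tnth t i)].

Definition enorm n (x : 'rV[R]_n) : R := Num.sqrt (\sum_i x 0 i ^+ 2).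

Definition eball n (x : 'rV[R]_n) (r : R) : set 'rV[R]_n :=
  [set y | enorm (y - x) < r].

Definition boundary (T : topologicalType) (A : set T) : set T :=
  closure A `\` interior A.

Definition unit_cube n : set 'rV[R]_n := [set x | forall i, 0 <= x 0 i <= 1].

Definition hyperplane n (i : 'I_n) (s : R) : set 'rV[R]_n :=
  [set x | x 0 i = s].

(* -oo for the empty set *)
Definition diam n (A : set 'rV[R]_n) : \bar R :=
  ereal_sup [set (enorm (x - y))%:E | x in A & y in A].

(* Covers are countable families indexed by a subset D of nat, so that the
   empty set has measure 0 also for d = 0, where every member costs 1. *)
Definition hausdorff_content n (d delta : R) (A : set 'rV[R]_n) : \bar R :=
  ereal_inf [set c | exists (D : set nat) (B : nat -> set 'rV[R]_n),
    [/\ A `<=` \bigcup_(k in D) B k,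
        (forall k, D k -> diam (B k) <= delta%:E)%E &
        c = \esum_(k in D) poweR (diam (B k)) d]].

Definition hausdorff_unnormalized n (d : R) (A : set 'rV[R]_n) : \bar R :=
  ereal_sup [set hausdorff_content d delta A | delta in [set x | 0 < x]].

(* The factor (volume of the unit ball of R^k) / 2^k is the usual one, for
   which the k-dimensional Hausdorff measure of R^k is Lebesgue measure. *)
Definition hausdorff_measure n (k : nat) (A : set 'rV[R]_n) : \bar R :=
  (Vol (@eball k 0 1) * ((2 ^+ k)^-1)%:E * hausdorff_unnormalized k%:R A)%E.

(* The supremum form of the definition gives -oo for the empty set, while
   inf {d >= 0 | H^d(A) = 0} would give 0; for n = 1 only the former makes a
   point s with an empty slice non-singular. *)
Definition hausdorff_dim n (A : set 'rV[R]_n) : \bar R :=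
  ereal_sup [set d%:E | d in
    [set d : R | 0 <= d /\ (0 < hausdorff_unnormalized d A)%E]].

Definition has_density n (U : set 'rV[R]_n) (t : R) (x : 'rV[R]_n) : Prop :=
  fine (Vol (U `&` eball x r)) / fine (Vol (eball x r)) @[r --> 0^'+] --> t.

Definition essential_boundary n (U : set 'rV[R]_n) : set 'rV[R]_n :=
  [set x | ~ has_density U 0 x /\ ~ has_density U 1 x].

Definition RelPer n (U : set 'rV[R]_n) : \bar R :=
  hausdorff_measure n.-1 (essential_boundary U `\` boundary (@unit_cube n)).

(* A hyperplane with normal +-e_i is hyperplane i c for some real c. *)
Definition cubical n (X : set 'rV[R]_n) : Prop :=
  [/\ compact X, X `<=` @unit_cube n &
      exists hs : seq ('I_n * R), boundary X `<=`
        \bigcup_(h in [set` hs]) hyperplane h.1 h.2].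

Definition slice n (X : set 'rV[R]_n) (i : 'I_n) (s : R) : set 'rV[R]_n :=
  boundary X `&` hyperplane i s.

Definition singular n (X : set 'rV[R]_n) (i : 'I_n) (s : R) : Prop :=
  hausdorff_dim (slice X i s) = (n.-1%:R)%:E.

Definition basis_vec n (i : 'I_n) : 'rV[R]_n := delta_mx 0 i.

Definition line_length n (X : set 'rV[R]_n) (i : 'I_n) (y : 'rV[R]_n) : \bar R :=
  lebesgue_measure [set t : R | X (y + t *: basis_vec i)].

Definition steiner_segment n (X : set 'rV[R]_n) (i : 'I_n) (y : 'rV[R]_n) :
    set R :=
  [set t | [/\ line_length X i y != 0%E, 0 <= t &
               (t%:E <= line_length X i y)%E]].

Definition steiner n (i : 'I_n) (X : set 'rV[R]_n) : set 'rV[R]_n :=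
  \bigcup_(y in hyperplane i 0 `&` @unit_cube n)
    [set y + t *: basis_vec i | t in steiner_segment X i y].

Definition symmetrized n (X : set 'rV[R]_n) : Prop :=
  forall i : 'I_n, steiner i X = X.

Definition open_cube0 n (r : R) : set 'rV[R]_n :=
  [set x | forall i, `|x 0 i| < r].

Definition special n (X : set 'rV[R]_n) : Prop :=
  [/\ cubical X /\ (0 < Vol X <= (2^-1)%:E)%E,
      symmetrized X,
      exists2 r : R, 0 < r &
        open_cube0 r `&` X = open_cube0 r `&` @unit_cube n &
      forall (i : 'I_n) (s t : R), 0 < s < 1 -> 0 < t < 1 ->
        singular X i s -> singular X i t -> s = t].

End definitions.

(* Main.v *)
(* Cut the cube along the hyperplanes that carry the boundary of X. For a fixed
   direction i, volume and perimeter are affine functions of the widths of the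
   slabs orthogonal to e_i, apart from the faces orthogonal to e_i, whose area
   is at least that of the symmetric difference of any two slabs. As the lower
   boundary of a planar convex hull consists of chords, two of the slabs, with
   suitable widths, have the same volume and no more perimeter. If A (the wider
   one) and B are these two slabs, then A u B, A and A n B with widths 1 - s,
   2s - 1 and 1 - s are no worse because perimeter is submodular, and selecting
   two of these three gives nested slabs. Doing this in every direction yields
   the special set directly, without Steiner symmetrization.
     The Hausdorff measure of a box in a hyperplane is at most kappa times its
   area, where kappa is the measure of a unit face (cover by small cubes), and
   a union of faces has at least that measure since the complementary faces of
   the unit face have at most that. The value of kappa plays no role; different
   hyperplanes are separated by removing thin neighbourhoods of the others. *)

Require Import Defs.
From HB Require Import structures.
From mathcomp Require Import all_boot all_order all_algebra.
From mathcomp Require Import all_classical all_reals all_analysis.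
From mathcomp Require Import perm measurable_realfun ring lra.

Set Implicit Arguments.
Unset Strict Implicit.
Unset Printing Implicit Defensive.

Import Order.TTheory GRing.Theory Num.Theory.
Import numFieldNormedType.Exports.

Local Open Scope classical_set_scope.
Local Open Scope ring_scope.

(** All requirements on a special set follow from one combinatorial normal form: every direction has
    just two slabs, meeting at an interior cut, and the cells kept in the upper slab are also kept
    in the lower one. Such a family of cells is a down-set. Hence every line parallel to an axis
    meets it in an initial segment, it contains the corner cell as soon as it is nonempty, and
    direction i has only one interior cut. The slabs given by the first chord need not be nested,
    which is why there is a second one. It keeps the volume because |A u B| + |A n B| = |A| + |B|
    turns the weights 1 - s, 2s - 1, 1 - s back into s for A and 1 - s for B. The directions do not
    disturb each other: the new slabs are slabs of the old set, their union or their intersection,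
    so monotonicity in another direction survives, and the widths of the other directions are
    unchanged. Geometry enters only at the two ends, through the weighted count [relper]: kappa
    times it is a lower bound for the Hausdorff measure attached to X and an upper bound for that of
    the new set. *)

(** * Chords below the mean of a weighted planar point set *)

(** Move the mean to the origin. If no point on the vertical axis and no chord across it passes at
    or below the origin, some line through the origin has all points on or above it, and strictly
    above it when x >= 0. Averaging then forces all weight onto x < 0, which contradicts mean 0. The
    choice a = b serves a point on the axis. *)
Lemma chord_below (R : realFieldType) (I : finType) (w v q : I -> R) :
  (forall a, 0 <= w a) -> \sum_a w a = 1 ->
  exists a b s, [/\ 0 < s < 1,
    s * v a + (1 - s) * v b = \sum_c w c * v c &
    s * q a + (1 - s) * q b <= \sum_c w c * q c].
Proof.
move=> w0 w1; set V := \sum_c w c * v c; set Q := \sum_c w c * q c.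
pose x a := v a - V; pose y a := q a - Q.
have wx : \sum_a w a * x a = 0.
  rewrite (eq_bigr (fun a => w a * v a - w a * V)) => [|a _]; last by rewrite mulrBr.
  by rewrite sumrB -mulr_suml w1 mul1r subrr.
have wy : \sum_a w a * y a = 0.
  rewrite (eq_bigr (fun a => w a * q a - w a * Q)) => [|a _]; last by rewrite mulrBr.
  by rewrite sumrB -mulr_suml w1 mul1r subrr.
case: (pickP [pred a | (x a == 0) && (y a <= 0)]) => [a /andP[/eqP xa ya]|noZ].
  exists a, a, 2^-1; rewrite /x /y in xa ya.
  by split; [apply/andP; split; lra | lra | lra].
case: (pickP [pred ab : I * I | [&& x ab.1 < 0, 0 < x ab.2 &
    y ab.1 * x ab.2 <= y ab.2 * x ab.1]]) => [[a b] /= /and3P[xa xb yab]|noNP].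
  have d0 : 0 < x b - x a by lra.
  have E s : s * v a + (1 - s) * v b = V + (s * x a + (1 - s) * x b).
    by rewrite /x; ring.
  have E' s : s * q a + (1 - s) * q b = Q + (s * y a + (1 - s) * y b).
    by rewrite /y; ring.
  exists a, b, (x b / (x b - x a)); split.
  - by rewrite divr_gt0//= ltr_pdivrMr// mul1r; lra.
  - by rewrite E; field; rewrite gt_eqF.
  - rewrite E' -[leRHS]addr0 lerD2l.
    have -> : x b / (x b - x a) * y a + (1 - x b / (x b - x a)) * y b =
      (y a * x b - y b * x a) / (x b - x a) by field; rewrite gt_eqF.
    by rewrite pmulr_lle0 ?invr_gt0// subr_le0.
have Z a : x a = 0 -> 0 < y a.
  by move=> xa; move: (noZ a); rewrite /= xa eqxx/= leNgt => /negbFE.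
have NP a b : x a < 0 -> 0 < x b -> y b * x a < y a * x b.
  by move=> xa xb; move: (noNP (a, b)); rewrite /= xa xb/= leNgt => /negbFE.
suff w00 a : w a = 0.
  by move: w1; rewrite big1// => /eqP; rewrite eq_sym oner_eq0.
case: (pickP [pred a | x a < 0]) => [a0 xa0|N0]; last first.
  have x0 c : 0 <= x c by rewrite leNgt; apply/negP => xc; move: (N0 c); rewrite /= xc.
  have wx0 c : w c * x c = 0.
    by apply: (psumr_eq0P (P := xpredT) _ wx) => // d _; rewrite mulr_ge0.
  have wP c : w c = 0 \/ 0 < y c.
    move/eqP: (wx0 c); rewrite mulf_eq0 => /orP[/eqP|/eqP/Z]; by [left|right].
  have wy0 c : w c * y c = 0.
    apply: (psumr_eq0P (P := xpredT) _ wy) => // d _.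
    by case: (wP d) => [->|/ltW yd]; rewrite ?mul0r// mulr_ge0.
  have [//|ya] := wP a.
  by move/eqP: (wy0 a); rewrite mulf_eq0 (gt_eqF ya) orbF => /eqP.
(* The least slope for which the line through the origin stays below all points left of the axis. *)
pose l := \big[Order.max/(y a0 / x a0)]_(a | x a < 0) (y a / x a).
have [a1 xa1 lE] : exists2 a1, x a1 < 0 & l = y a1 / x a1.
  rewrite /l; apply: (big_ind (fun z => exists2 a1, x a1 < 0 & z = y a1 / x a1)).
  - by exists a0.
  - by move=> z z' hz hz'; case: (leP z z').
  - by move=> c xc; exists c.
have lP c : x c < 0 -> l * x c <= y c.
  move=> xc; rewrite -ler_ndivrMr//.
  by rewrite /l (bigD1 c)//= le_max lexx.
have lZ c : 0 <= x c -> l * x c < y c.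
  rewrite le_eqVlt => /orP[/eqP xc|xc]; first by rewrite -xc mulr0 Z.
  rewrite lE -subr_gt0.
  have -> : y c - y a1 / x a1 * x c = (y a1 * x c - y c * x a1) / - x a1.
    by field; rewrite lt_eqF.
  by rewrite divr_gt0 ?oppr_gt0// subr_gt0 NP.
have lW c : 0 <= y c - l * x c.
  by rewrite subr_ge0; case: (ltP (x c) 0) => xc; [exact: lP|exact/ltW/lZ].
have ws0 c : w c * (y c - l * x c) = 0.
  apply: (psumr_eq0P (P := xpredT) (F := fun c => w c * (y c - l * x c))) => //.
    by move=> d _; rewrite mulr_ge0.
  rewrite (eq_bigr (fun a => w a * y a - l * (w a * x a))) => [|d _]; last by ring.
  by rewrite sumrB wy -mulr_sumr wx mulr0 subrr.
have wP c : w c = 0 \/ x c < 0.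
  have [xc|xc] := ltP (x c) 0; first by right.
  left; move/eqP: (ws0 c); rewrite mulf_eq0 subr_eq0 (gt_eqF (lZ _ xc)) orbF.
  by move/eqP.
have [//|xa] := wP a.
have : w a * - x a = 0.
  apply: (psumr_eq0P (P := xpredT) (F := fun c => w c * - x c)) => //.
    by move=> d _; case: (wP d) => [->|xd]; rewrite ?mul0r// mulr_ge0//; lra.
  rewrite (eq_bigr (fun a => - (w a * x a))) => [|d _]; last by rewrite mulrN.
  by rewrite sumrN wx oppr0.
by move/eqP; rewrite mulf_eq0 oppr_eq0 (lt_eqF xa) orbF => /eqP.
Qed.

(** * Cell complexes on a product grid *)

Section grid.
Context (R : realFieldType) (n M : nat).

Local Notation I := 'I_M.+2.
Local Notation K := {ffun 'I_n -> I}.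
Implicit Types (w : 'I_n -> I -> R) (A B C D : pred K) (k : K) (i j : 'I_n) (a b : I).

Definition upd k (i : 'I_n) (a : I) : K :=
  [ffun j => if j == i then a else k j].

Lemma updii k i a : upd k i a i = a. Proof. by rewrite ffunE eqxx. Qed.

Lemma upd_neq k i a j : j != i -> upd k i a j = k j.
Proof. by move=> ji; rewrite ffunE (negbTE ji). Qed.

Lemma updid k i : upd k i (k i) = k.
Proof. by apply/ffunP => j; rewrite ffunE; case: eqP => [->|]. Qed.

Lemma upd_upd k i a b : upd (upd k i a) i b = upd k i b.
Proof. by apply/ffunP => j; rewrite !ffunE; case: eqP. Qed.

Lemma updC k i j a b : i != j -> upd (upd k i a) j b = upd (upd k j b) i a.
Proof.
move=> ij; apply/ffunP => l; rewrite !ffunE.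
by case: (eqVneq l j) => [->|//]; rewrite eq_sym (negbTE ij).
Qed.

(* w i a is the width of the a-th slab orthogonal to e_i (widths may vanish)
   and A is the set of cells that are kept. *)
Definition mass w A : R := \sum_(k : K) (\prod_j w j (k j)) * (A k)%:R.

(* A set of cells of one slab is a predicate on all cells that does not depend
   on the i-th index, hence the normalization k i = 0. *)
Definition slab_mass w i A : R :=
  \sum_(k : K | k i == ord0) (\prod_(j | j != i) w j (k j)) * (A k)%:R.

Definition layer i a A : pred K := fun k => A (upd k i a).

(** Only the inner interfaces are counted, as for the relative perimeter. The xor of two layers does
    not depend on the i-th index and the widths in direction i sum to 1, so [mass] computes an
    (n-1)-dimensional area here. *)
Definition area w i A : R :=
  \sum_(b < M.+1) mass w (fun k => layer i (inord b) A k (+) layer i (inord b.+1) A k).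

Definition relper w A : R := \sum_i area w i A.

Lemma massE w i A : mass w A = \sum_a w i a * slab_mass w i (layer i a A).
Proof.
rewrite /mass (partition_big (fun k => k i) xpredT)//=; apply: eq_bigr => a _.
rewrite mulr_sumr (reindex_onto (fun k => upd k i a) (fun k => upd k i ord0))/=.
  apply: eq_big => [k|k]; rewrite updii ?eqxx/=.
    rewrite upd_upd; apply/eqP/eqP => [<-|<-]; rewrite ?updii//.
    by rewrite updid.
  move=> _; rewrite (bigD1 i)//= updii mulrA; congr (_ * _ * _).
  by apply: eq_bigr => j ji; rewrite upd_neq.
by move=> k /eqP <-; rewrite upd_upd updid.
Qed.

Lemma eq_mass w A B : A =1 B -> mass w A = mass w B.
Proof. by move=> AB; apply: eq_bigr => k _; rewrite AB. Qed.

Lemma eq_slab_mass w w' i A B :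
  (forall j a, j != i -> w j a = w' j a) -> A =1 B ->
  slab_mass w i A = slab_mass w' i B.
Proof.
move=> ww' AB; apply: eq_bigr => k _; rewrite AB; congr (_ * _).
by apply: eq_bigr => j ji; rewrite ww'.
Qed.

Definition weights w := forall i, (forall a, 0 <= w i a) /\ \sum_a w i a = 1.

Lemma mass_layer w i a A : weights w ->
  mass w (layer i a A) = slab_mass w i (layer i a A).
Proof.
move=> /(_ i)[_ w1]; rewrite (massE _ i) -[RHS]mul1r -w1 mulr_suml.
apply: eq_bigr => b _; congr (_ * _); apply: eq_slab_mass => // k.
by rewrite /layer upd_upd.
Qed.

Lemma slab_mass_ge0 w i A : weights w -> 0 <= slab_mass w i A.
Proof.
move=> ww; apply: sumr_ge0 => k _; rewrite mulr_ge0 ?ler0n//.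
by apply: prodr_ge0 => j _; have [] := ww j.
Qed.

Lemma ler_slab_mass w i A B : weights w -> (forall k, A k -> B k) ->
  slab_mass w i A <= slab_mass w i B.
Proof.
move=> ww AB; apply: ler_sum => k _; apply: ler_wpM2l.
  by apply: prodr_ge0 => j _; have [] := ww j.
by rewrite ler_nat; case: (A k) (AB k) => // ->.
Qed.

Lemma slab_massD_le w i A B C D : weights w ->
  (forall k, (A k + B k <= C k + D k)%N) ->
  slab_mass w i A + slab_mass w i B <= slab_mass w i C + slab_mass w i D.
Proof.
move=> ww ABCD; rewrite /slab_mass -!big_split; apply: ler_sum => k _ /=.
rewrite -!mulrDr -!natrD; apply: ler_wpM2l; last by rewrite ler_nat.
by apply: prodr_ge0 => j _; have [] := ww j.
Qed.

Lemma slab_massD w i A B C D :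
  (forall k, (A k + B k = C k + D k)%N) ->
  slab_mass w i A + slab_mass w i B = slab_mass w i C + slab_mass w i D.
Proof.
move=> ABCD; rewrite /slab_mass -!big_split; apply: eq_bigr => k _ /=.
by rewrite -!mulrDr -!natrD ABCD.
Qed.

Definition slab_dist w i A B := slab_mass w i (fun k => A k (+) B k).

Definition slab_relper w i A : R :=
  \sum_(j | j != i) \sum_(b < M.+1)
    slab_dist w i (layer j (inord b) A) (layer j (inord b.+1) A).

Lemma areaE w i A : weights w -> area w i A =
  \sum_(b < M.+1) slab_dist w i (layer i (inord b) A) (layer i (inord b.+1) A).
Proof.
move=> ww; rewrite /area; apply: eq_bigr => b _.
rewrite (@eq_mass _ _ (layer i ord0 (fun k => layer i (inord b) A k (+) layer i (inord b.+1) A k))).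
  rewrite mass_layer//; apply: eq_slab_mass => // k.
  by rewrite /layer !upd_upd.
by move=> k; rewrite /layer !upd_upd.
Qed.

(** Interfaces orthogonal to another direction j are masses themselves, so slicing them along e_i
    makes them affine in the widths [w i]; the interfaces orthogonal to e_i depend on the other
    widths only. *)
Lemma relperE w i A : weights w -> relper w A =
  area w i A + \sum_a w i a * slab_relper w i (layer i a A).
Proof.
move=> ww; rewrite /relper (bigD1 i)//=; congr (_ + _).
rewrite /area /slab_relper.
transitivity (\sum_(j | j != i) \sum_(b < M.+1) \sum_a w i a *
    slab_dist w i (layer j (inord b) (layer i a A))
      (layer j (inord b.+1) (layer i a A))); last first.
  under [LHS]eq_bigr do rewrite exchange_big/=.
  rewrite [LHS]exchange_big/=; apply: eq_bigr => a _.
  rewrite mulr_sumr; apply: eq_bigr => j ji.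
  by rewrite mulr_sumr.
apply: eq_bigr => j ji; apply: eq_bigr => b _.
rewrite (massE _ i); apply: eq_bigr => a _; congr (_ * _).
by apply: eq_slab_mass => // k; rewrite /layer/= ![upd (upd k j _) i _]updC.
Qed.

Lemma slab_dist_triangle w i A B C : weights w ->
  slab_dist w i A C <= slab_dist w i A B + slab_dist w i B C.
Proof.
move=> ww; rewrite -[leLHS]addr0.
have <- : slab_mass w i (fun=> false) = 0.
  by apply: big1 => k _; rewrite mulr0.
by apply: slab_massD_le => // k; case: (A k) (B k) (C k) => [] [] [].
Qed.

Lemma slab_distC w i A B : slab_dist w i A B = slab_dist w i B A.
Proof. by apply: eq_slab_mass => // k; rewrite addbC. Qed.

Lemma slab_distxx w i A : slab_dist w i A A = 0.
Proof. by apply: big1 => k _; rewrite addbb mulr0. Qed.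

(** The way from slab a to slab b crosses each interface at most once, so the triangle inequality
    telescopes. *)
Lemma slab_dist_area w i A a b : weights w ->
  slab_dist w i (layer i a A) (layer i b A) <= area w i A.
Proof.
move=> ww; rewrite areaE//.
wlog ab : a b / (a <= b)%N.
  by move=> H; case: (leqP a b) => [/H//|/ltnW/H]; rewrite slab_distC.
pose d (c : nat) := slab_dist w i (layer i (inord c) A) (layer i (inord c.+1) A).
suff H e : (a + e < M.+2)%N ->
    slab_dist w i (layer i a A) (layer i (inord (a + e)) A) <=
    \sum_(a <= c < a + e) d c.
  have := H (b - a)%N; rewrite subnKC// inord_val => /(_ (ltn_ord _))/le_trans; apply.
  have d0 c : 0 <= d c by exact: slab_mass_ge0.
  rewrite -[X in _ <= X](big_mkord xpredT d) (@big_cat_nat _ _ _ a 0)//=; last first.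
    by rewrite (leq_trans ab) // -ltnS.
  rewrite (@big_cat_nat _ _ _ b a M.+1)//=; last by rewrite -ltnS.
  rewrite -[X in X <= _]add0r lerD ?sumr_ge0// -[X in X <= _]addr0 lerD ?sumr_ge0//.
elim: e => [|e IH] ae.
  by rewrite addn0 inord_val slab_distxx big_geq.
rewrite addnS big_nat_recr ?leq_addr//=.
apply: le_trans (slab_dist_triangle i _ (layer i (inord (a + e)) A) _ ww) _.
rewrite lerD2r IH//.
by rewrite (leq_ltn_trans _ ae)// leq_add2l.
Qed.

End grid.

(** * Reduction to two nested slabs in every direction *)

Section compression.
Context (R : realFieldType) (n M : nat).

Local Notation I := 'I_M.+2.
Local Notation K := {ffun 'I_n -> I}.
Local Notation one := (inord 1 : I).
Implicit Types (w : 'I_n -> I -> R) (A B C D : pred K) (k : K) (i j : 'I_n)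
  (a b : I).

Lemma one_neq0 : one != ord0.
Proof. by rewrite -val_eqE/= inordK. Qed.

(** The index type keeps its size under compression: all nonzero indices carry the same cells, and
    the slabs from 2 on will have width 0. *)
Definition two_layered i A :=
  (forall k a, a != ord0 -> A (upd k i a) = A (upd k i one)) /\
  (forall k, A (upd k i one) -> A (upd k i ord0)).

Lemma two_layered_layer i j a A : j != i ->
  two_layered j A -> two_layered j (layer i a A).
Proof.
move=> ji [h1 h2]; split=> [k b b0|k]; rewrite /layer !(updC _ _ _ ji).
  exact: h1.
exact: h2.
Qed.

Lemma two_layeredU j A B : two_layered j A -> two_layered j B ->
  two_layered j (fun k => A k || B k).
Proof.
move=> [A1 A2] [B1 B2]; split=> [k b b0|k]; first by rewrite A1// B1.
by move=> /orP[/A2 ->//|/B2 ->]; rewrite orbT.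
Qed.

Lemma two_layeredI j A B : two_layered j A -> two_layered j B ->
  two_layered j (fun k => A k && B k).
Proof.
move=> [A1 A2] [B1 B2]; split=> [k b b0|k]; first by rewrite A1// B1.
by move=> /andP[/A2 -> /B2 ->].
Qed.

(** Submodularity holds already for a single pair of neighbouring cells, where it is an inequality
    between booleans. *)
Lemma slab_relper_submodular w i A B : weights w ->
  slab_relper w i (fun k => A k || B k) + slab_relper w i (fun k => A k && B k)
  <= slab_relper w i A + slab_relper w i B.
Proof.
move=> ww; rewrite /slab_relper -!big_split; apply: ler_sum => j _ /=.
rewrite -!big_split; apply: ler_sum => b _ /=; apply: slab_massD_le => // k.
rewrite /layer.
by case: (A _) (B _) (A _) (B _) => [] [] [] [].
Qed.

Lemma nested_slabs w A i : weights w -> exists B0 B1 s,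
  [/\ 0 < s < 1,
      s * slab_mass w i B0 + (1 - s) * slab_mass w i B1 = mass w A,
      s * slab_relper w i B0 + (1 - s) * slab_relper w i B1 <=
        \sum_a w i a * slab_relper w i (layer i a A) &
      slab_dist w i B0 B1 <= area w i A] /\
  [/\ forall k, B1 k -> B0 k,
      forall k a, (B0 (upd k i a) = B0 k) * (B1 (upd k i a) = B1 k) &
      forall j, j != i -> two_layered j A -> two_layered j B0 /\ two_layered j B1].
Proof.
move=> ww.
have [a [b [s [s01 sv sq]]]] := chord_below (fun a => slab_mass w i (layer i a A))
  (fun a => slab_relper w i (layer i a A)) (ww i).1 (ww i).2.
rewrite -massE in sv.
(* Let a be the wider slab, so that the weight 2s - 1 below is nonnegative. *)
wlog s2 : a b s s01 sv sq / 2^-1 <= s.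
  move=> H; have [|s2] := leP 2^-1 s; first exact: (H a b s).
  case/andP: s01 => s0 s1.
  apply: (H b a (1 - s)); [apply/andP; split; lra | by rewrite -sv; ring | | lra].
  by apply: le_trans sq; rewrite le_eqVlt; apply/orP; left; apply/eqP; ring.
have [s0 s1] := andP s01.
pose F (c : 'I_3) : pred K := fun k => match nat_of_ord c with
  | 0 => layer i a A k || layer i b A k
  | 1 => layer i a A k
  | _ => layer i a A k && layer i b A k end.
pose wF (c : 'I_3) : R := match nat_of_ord c with 1 => 2 * s - 1 | _ => 1 - s end.
have wF0 c : 0 <= wF c by rewrite /wF; case: (nat_of_ord c) => [|[|_]]; lra.
have wF1 : \sum_c wF c = 1 by rewrite !big_ord_recl big_ord0 /wF/=; ring.
have [c [d [t [t01 tv tq]]]] := chord_below (fun c => slab_mass w i (F c))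
  (fun c => slab_relper w i (F c)) wF0 wF1.
(* [F] decreases in its index, so this order gives nestedness. *)
wlog cd : c d t t01 tv tq / (c <= d)%N.
  move=> H; have [|dc] := leqP c d; first exact: (H c d t).
  case/andP: t01 => t0 t1.
  apply: (H d c (1 - t)); [apply/andP; split; lra | by rewrite -tv; ring | | exact: ltnW].
  by apply: le_trans tq; rewrite le_eqVlt; apply/orP; left; apply/eqP; ring.
exists (F c), (F d), t; split; split => //.
- rewrite tv !big_ord_recl big_ord0 /wF/= addr0 -sv.
  have -> : slab_mass w i (F ord0) =
      slab_mass w i (layer i a A) + slab_mass w i (layer i b A) -
      slab_mass w i (F (lift ord0 (lift ord0 ord0))).
    apply/eqP; rewrite eq_sym subr_eq; apply/eqP/slab_massD => k.
    by rewrite /F/=; case: (layer _ _ _ _) (layer _ _ _ _) => [] [].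
  by rewrite /F/=; ring.
- apply: le_trans tq (le_trans _ sq).
  rewrite !big_ord_recl big_ord0 /wF/= addr0.
  have := slab_relper_submodular i (layer i a A) (layer i b A) ww.
  rewrite /F/=; move: (slab_relper _ _ _) (slab_relper _ _ _) => u l h.
  have : (1 - s) * (u + l) <= (1 - s) *
    (slab_relper w i (layer i a A) + slab_relper w i (layer i b A)).
    by rewrite ler_wpM2l//; lra.
  by move: (slab_relper _ _ _) (slab_relper _ _ _) => x y; lra.
(* Any two of the three sets differ only where layers a and b differ. *)
- apply: le_trans (slab_dist_area i A a b ww); apply: ler_slab_mass => // k.
  rewrite /F; case: (nat_of_ord c) (nat_of_ord d) => [|[|p]] [|[|q]];
  by case: (layer i a A k); case: (layer i b A k).
- move=> k; rewrite /F.
  move: cd; case: (nat_of_ord c) (nat_of_ord d) => [|[|p]] [|[|q]]//=;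
  by case: (layer i a A k); case: (layer i b A k).
- by move=> k e; rewrite /F/layer !upd_upd.
- move=> j ji Aj.
  have F3 e : two_layered j (F e).
    rewrite /F; case: (nat_of_ord e) => [|[|p]].
    + by apply: two_layeredU; exact: two_layered_layer.
    + exact: two_layered_layer.
    + by apply: two_layeredI; exact: two_layered_layer.
  by split; exact: F3.
Qed.

Definition compressed w A i :=
  [/\ two_layered i A, 0 < w i ord0, 0 < w i one & w i ord0 + w i one = 1].

Lemma compress w A i : weights w -> exists w' A',
  [/\ weights w', mass w' A' = mass w A, relper w' A' <= relper w A,
      compressed w' A' i &
      forall j, j != i -> compressed w A j -> compressed w' A' j].
Proof.
move=> ww.
have [B0 [B1 [s [[s01 sv sq sd] [B10 Bi Bj]]]]] := nested_slabs A i ww.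
have [s0 s1] := andP s01.
pose w' j a := if j == i then
  (if a == ord0 then s else if a == one then 1 - s else 0) else w j a.
pose A' : pred K := fun k => if k i == ord0 then B0 k else B1 k.
have w'i j a : j != i -> w' j a = w j a by rewrite /w' => /negbTE ->.
have sumw' (F : I -> R) : \sum_a w' i a * F a = s * F ord0 + (1 - s) * F one.
  rewrite (bigD1 ord0)//= (bigD1 one) ?one_neq0//= big1 ?addr0.
    by rewrite /w' !eqxx (negbTE one_neq0).
  by move=> a /andP[/negbTE a0 /negbTE a1]; rewrite /w' eqxx a0 a1 mul0r.
have ww' : weights w'.
  move=> j; case: (eqVneq j i) => [->|ji].
    split=> [a|]; first by rewrite /w' eqxx; case: ifP => _; [|case: ifP => _]; lra.
    have := sumw' (fun=> 1); under eq_bigr do rewrite mulr1.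
    by move=> ->; rewrite !mulr1 addrC subrK.
  split=> [a|]; first by rewrite w'i//; exact: (ww j).1.
  by under eq_bigr do rewrite w'i//; exact: (ww j).2.
have A'0 : layer i ord0 A' =1 B0.
  by move=> k; rewrite /layer /A' updii eqxx Bi.
have A'1 a : a != ord0 -> layer i a A' =1 B1.
  by move=> /negbTE a0 k; rewrite /layer /A' updii a0 Bi.
have E A1 A2 : A1 =1 A2 -> slab_mass w' i A1 = slab_mass w i A2.
  by move=> A12; apply: eq_slab_mass => // j a ji; rewrite w'i.
have Er A1 A2 : A1 =1 A2 -> slab_relper w' i A1 = slab_relper w i A2.
  move=> A12; apply: eq_bigr => j _; apply: eq_bigr => b _.
  by apply: E => k; rewrite /layer !A12.
exists w', A'; split => //.
- by rewrite (massE _ i) sumw' (E _ _ A'0) (E _ _ (A'1 _ one_neq0)).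
- rewrite (relperE i _ ww') (relperE i _ ww) sumw' (Er _ _ A'0).
  rewrite (Er _ _ (A'1 _ one_neq0)) lerD//.
  (* Only the interface between slabs 0 and 1 contributes: all later slabs carry the same cells
     [B1]. *)
  apply: le_trans sd; rewrite areaE// big_ord_recl big1 ?addr0.
    rewrite /slab_dist (E _ (fun k => B0 k (+) B1 k))// => k.
    have -> : inord 0 = ord0 :> I by apply/val_inj; rewrite /= inordK.
    by rewrite A'0 A'1 ?one_neq0.
  move=> b _; rewrite /slab_dist (E _ (fun=> false)); last first.
    move=> k; rewrite !A'1 ?addbb// -val_eqE/= inordK//.
      exact: ltn_ord (lift ord0 b).
    exact: ltnW (ltn_ord (lift ord0 b)).
  by apply: big1 => k _; rewrite mulr0.
- split.
  + split=> [k a a0|k]; rewrite /A' !updii ?eqxx (negbTE one_neq0) ?(negbTE a0) ?Bi//.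
    exact: B10.
  + by rewrite /w' !eqxx; lra.
  + by rewrite /w' !eqxx (negbTE one_neq0); lra.
  + by rewrite /w' !eqxx (negbTE one_neq0); lra.
- move=> j ji [Aj w0 w1 w01]; rewrite /compressed !w'i//; split => //.
  have [[B01 B02] [B11 B12]] := Bj j ji Aj.
  split=> [k a a0|k]; rewrite /A' !(upd_neq _ _ _) 1?eq_sym//; case: ifP => _.
  + exact: B01.
  + exact: B11.
  + exact: B02.
  + exact: B12.
Qed.

Lemma compress_all w A : weights w -> exists w' A',
  [/\ weights w', mass w' A' = mass w A, relper w' A' <= relper w A &
      forall i, compressed w' A' i].
Proof.
move=> ww.
suff [w' [A' [ww' mA rA cA]]] : exists w' A',
  [/\ weights w', mass w' A' = mass w A, relper w' A' <= relper w A &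
      forall i, i \in enum 'I_n -> compressed w' A' i].
  by exists w', A'; split => // i; apply: cA; rewrite mem_enum.
elim: (enum _) => [|i s [w1 [A1 [ww1 m1 r1 c1]]]]; first by exists w, A.
have [w2 [A2 [ww2 m2 r2 c2 c2']]] := compress A1 i ww1.
exists w2, A2; split => //; first by rewrite m2.
  exact: le_trans r2 r1.
move=> j; rewrite inE; case: (eqVneq j i) => [-> //|ji /= js].
by apply: c2' => //; exact: c1.
Qed.

End compression.

(** * Sums of extrema of nonnegative extended reals *)

Section ereal_extrema.
Context (R : realType).
Implicit Types (S T : set (\bar R)) (z : \bar R).
Local Open Scope ereal_scope.

Lemma le_add_ereal_inf S T z : (forall a, S a -> 0 <= a) -> (forall b, T b -> 0 <= b) ->
  (forall a b, S a -> T b -> z <= a + b) -> z <= ereal_inf S + ereal_inf T.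
Proof.
move=> S0 T0 H.
have iS0 : 0 <= ereal_inf S by apply: le_ereal_inf_tmp => a /S0.
have iT0 : 0 <= ereal_inf T by apply: le_ereal_inf_tmp => a /T0.
have [iSy|iSy] := eqVneq (ereal_inf S) +oo;
  first by rewrite iSy addye ?leey// gt_eqF// (lt_le_trans _ iT0).
have [iTy|iTy] := eqVneq (ereal_inf T) +oo;
  first by rewrite iTy addey ?leey// gt_eqF// (lt_le_trans _ iS0).
have fS : ereal_inf S \is a fin_num by rewrite ge0_fin_numE// ltey.
have fT : ereal_inf T \is a fin_num by rewrite ge0_fin_numE// ltey.
apply/lee_addgt0Pr => e e0.
have e2 : (0 < e / 2)%R by rewrite divr_gt0.
have [a Sa aS] := lb_ereal_inf_adherent e2 fS.
have [b Tb bT] := lb_ereal_inf_adherent e2 fT.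
rewrite (splitr e) EFinD addeACA.
exact: le_trans (H _ _ Sa Tb) (leeD (ltW aS) (ltW bT)).
Qed.

Lemma le_add_ereal_sup S T z : (forall a, S a -> 0 <= a) -> (forall b, T b -> 0 <= b) ->
  S !=set0 -> T !=set0 ->
  (forall a b, S a -> T b -> a + b <= z) -> ereal_sup S + ereal_sup T <= z.
Proof.
move=> S0 T0 [a0 Sa0] [b0 Tb0] H.
have [->|zy] := eqVneq z +oo; first exact: leey.
have z0 : 0 <= z by apply: le_trans (adde_ge0 (S0 _ Sa0) (T0 _ Tb0)) (H _ _ Sa0 Tb0).
have fz : z \is a fin_num by rewrite ge0_fin_numE// ltey.
have sT a : S a -> ereal_sup T <= z - a.
  move=> Sa; apply: ge_ereal_sup => b Tb.
  have fa : a \is a fin_num.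
    rewrite ge0_fin_numE ?S0//; apply: (@le_lt_trans _ _ z); last by rewrite ltey.
    by apply: le_trans (leeDl _ (T0 _ Tb)) (H _ _ Sa Tb).
  by rewrite leeBrDr// addeC H.
have sT0 : 0 <= ereal_sup T by apply: le_trans (T0 _ Tb0) _; exact: ereal_sup_ubound.
have fT : ereal_sup T \is a fin_num.
  rewrite ge0_fin_numE//; apply: le_lt_trans (sT _ Sa0) _.
  apply: (@le_lt_trans _ _ z); last by rewrite ltey.
  by rewrite -[leRHS]adde0 leeD// leeNl oppe0 S0.
rewrite -leeBrDr//; apply: ge_ereal_sup => a Sa.
have fa : a \is a fin_num.
  rewrite ge0_fin_numE ?S0//; apply: (@le_lt_trans _ _ z); last by rewrite ltey.
  by apply: le_trans (leeDl _ (T0 _ Tb0)) (H _ _ Sa Tb0).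
by rewrite leeBrDr// addeC -leeBrDr// sT.
Qed.

End ereal_extrema.

(** * Hausdorff measures *)

Section hausdorff.
Context (R : realType) (n : nat).
Implicit Types (A B F G : set 'rV[R]_n) (d r : R).

Lemma hausdorff_content_ge0 d r A : (0 <= hausdorff_content d r A)%E.
Proof.
apply: le_ereal_inf_tmp => _ [D [B [_ _ ->]]].
by apply: esum_ge0 => k _; exact: poweR_ge0.
Qed.

Lemma le_hausdorff_content d r A B : A `<=` B ->
  (hausdorff_content d r A <= hausdorff_content d r B)%E.
Proof.
move=> AB; apply: ereal_inf_le_tmp => _ [D [C [BC Cr ->]]].
by exists D, C; split => //; exact: subset_trans BC.
Qed.

Lemma hausdorff_content_anti d r s A : r <= s ->
  (hausdorff_content d s A <= hausdorff_content d r A)%E.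
Proof.
move=> rs; apply: ereal_inf_le_tmp => _ [D [C [BC Cr ->]]].
by exists D, C; split => // k Dk; apply: le_trans (Cr _ Dk) _; rewrite lee_fin.
Qed.

Lemma hausdorff_content_diam d r A : (diam A <= r%:E)%E ->
  (hausdorff_content d r A <= poweR (diam A) d)%E.
Proof.
move=> Ar; apply: ereal_inf_lbound; exists [set 0%N], (fun=> A); split => //.
  by move=> x Ax; exists 0%N.
by rewrite esum_set1// poweR_ge0.
Qed.

Lemma hausdorff_content0 d r : hausdorff_content d r (@set0 'rV[R]_n) = 0%E.
Proof.
apply/eqP; rewrite eq_le hausdorff_content_ge0 andbT.
by apply: ereal_inf_lbound; exists set0, (fun=> set0); split => //; rewrite esum_set0.
Qed.

Lemma hausdorff_contentU d r A B :
  (hausdorff_content d r (A `|` B) <=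
   hausdorff_content d r A + hausdorff_content d r B)%E.
Proof.
apply: le_add_ereal_inf.
- by move=> _ [D [C [_ _ ->]]]; apply: esum_ge0 => k _; exact: poweR_ge0.
- by move=> _ [D [C [_ _ ->]]]; apply: esum_ge0 => k _; exact: poweR_ge0.
move=> _ _ [D1 [B1 [A1 d1 ->]]] [D2 [B2 [A2 d2 ->]]].
apply: ereal_inf_lbound.
(* The two covers are interleaved: even indices for A, odd ones for B. *)
pose B' k := if odd k then B2 k./2 else B1 k./2.
pose E1 := [set k.*2 | k in D1]; pose E2 := [set k.*2.+1 | k in D2].
have B'1 k : B' k.*2 = B1 k by rewrite /B' odd_double doubleK.
have B'2 k : B' k.*2.+1 = B2 k by rewrite /B' /= odd_double uphalf_double.
exists (E1 `|` E2), B'; split.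
- move=> x [/A1[k Dk Bk]|/A2[k Dk Bk]].
    by exists k.*2; [left; exists k|rewrite B'1].
  by exists k.*2.+1; [right; exists k|rewrite B'2].
- by move=> _ [[k Dk <-]|[k Dk <-]]; rewrite ?B'1 ?B'2; [exact: d1|exact: d2].
rewrite [RHS](esumID [set k | odd k]) => [|k _]; last exact: poweR_ge0.
rewrite (_ : (_ `|` _) `&` _ = E2); last first.
  apply/seteqP; split => [k [[[l Dl <-]|//]]|k [l Dl <-]]; first by rewrite /= odd_double.
  by split; [right; exists l|rewrite /= odd_double].
rewrite (_ : (_ `|` _) `&` _ = E1); last first.
  apply/seteqP; split => [k [[//|[l Dl <-]]]|k [l Dl <-]]; first by rewrite /= odd_double.
  by split; [left; exists l|rewrite /= odd_double].
rewrite /E1 /E2 !esum_image; last 2 first.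
- by move=> k l _ _ /double_inj.
- by move=> k l _ _ [/double_inj].
rewrite addeC; congr (_ + _)%E; apply: eq_esum => k _; by rewrite ?B'1 ?B'2.
Qed.

Lemma hausdorff_ge0 d A : (0 <= hausdorff_unnormalized d A)%E.
Proof.
apply: le_trans (hausdorff_content_ge0 d 1 A) _; apply: ereal_sup_ubound.
by exists 1 => //=.
Qed.

Lemma le_hausdorff d A B : A `<=` B ->
  (hausdorff_unnormalized d A <= hausdorff_unnormalized d B)%E.
Proof.
move=> AB; apply: ge_ereal_sup => _ [r r0 <-].
apply: le_trans (le_hausdorff_content d r AB) _.
by apply: ereal_sup_ubound; exists r.
Qed.

Lemma hausdorff0 d : hausdorff_unnormalized d (@set0 'rV[R]_n) = 0%E.
Proof.
apply/eqP; rewrite eq_le hausdorff_ge0 andbT.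
by apply: ge_ereal_sup => _ [r r0 <-]; rewrite hausdorff_content0.
Qed.

Lemma hausdorffU d A B : (hausdorff_unnormalized d (A `|` B) <=
  hausdorff_unnormalized d A + hausdorff_unnormalized d B)%E.
Proof.
apply: ge_ereal_sup => _ [r r0 <-]; apply: le_trans (hausdorff_contentU d r A B) _.
by apply: leeD; apply: ereal_sup_ubound; exists r.
Qed.

Lemma subadditive_cover (phi : set 'rV[R]_n -> \bar R) (I : finType) (P : pred I)
    (F : I -> set 'rV[R]_n) A :
  (forall B C, B `<=` C -> phi B <= phi C)%E -> phi set0 = 0%E ->
  (forall B C, phi (B `|` C) <= phi B + phi C)%E ->
  (forall x, A x -> exists2 i, P i & F i x) ->
  (phi A <= \sum_(i | P i) phi (F i))%E.
Proof.
move=> phi_le phi0 phiU AF.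
apply: (@le_trans _ _ (phi (\big[setU/set0]_(i | P i) F i))).
  apply: phi_le => x /AF[i Pi Fi]; rewrite -bigcup_seq_cond.
  by exists i => //=; rewrite mem_index_enum.
apply: (big_ind2 (fun S s => phi S <= s)%E) => [|S s S' s' Ss Ss'|//].
  by rewrite phi0.
by apply: le_trans (phiU S S') _; exact: leeD.
Qed.

Lemma hausdorff_content_cover (I : finType) (P : pred I) (F : I -> set 'rV[R]_n) d r A :
  (forall x, A x -> exists2 i, P i & F i x) ->
  (hausdorff_content d r A <= \sum_(i | P i) hausdorff_content d r (F i))%E.
Proof.
apply: subadditive_cover.
- exact: le_hausdorff_content.
- exact: hausdorff_content0.
- exact: hausdorff_contentU.
Qed.

Lemma hausdorff_cover (I : finType) (P : pred I) (F : I -> set 'rV[R]_n) d A :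
  (forall x, A x -> exists2 i, P i & F i x) ->
  (hausdorff_unnormalized d A <= \sum_(i | P i) hausdorff_unnormalized d (F i))%E.
Proof.
apply: subadditive_cover; [exact: le_hausdorff|exact: hausdorff0|exact: hausdorffU].
Qed.

(** The metric outer measure property: a cover by sets of diameter less than e splits into the
    members that meet F, which miss G, and the others. *)
Lemma hausdorff_separatedU d (e : R) F G : 0 < e ->
  (forall x y, F x -> G y -> e <= enorm (x - y)) ->
  (hausdorff_unnormalized d F + hausdorff_unnormalized d G <=
   hausdorff_unnormalized d (F `|` G))%E.
Proof.
move=> e0 FG; apply: le_add_ereal_sup.
- by move=> _ [r _ <-]; exact: hausdorff_content_ge0.
- by move=> _ [r _ <-]; exact: hausdorff_content_ge0.
- by exists (hausdorff_content d 1 F); exists 1 => /=.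
- by exists (hausdorff_content d 1 G); exists 1 => /=.
move=> _ _ [r r0 <-] [s s0 <-].
pose t := Order.min (Order.min r s) (e / 2).
have t0 : 0 < t by rewrite !lt_min r0 s0/= divr_gt0.
apply: (@le_trans _ _ (hausdorff_content d t (F `|` G))); last first.
  by apply: ereal_sup_ubound; exists t.
apply: (@le_trans _ _ (hausdorff_content d t F + hausdorff_content d t G)%E).
  by apply: leeD; apply: hausdorff_content_anti; rewrite /t !ge_min lexx ?orbT.
apply: le_ereal_inf_tmp => _ [D [B [FGB Bt ->]]].
pose DF := [set k | B k `&` F !=set0].
rewrite (esumID DF) => [|k _]; last exact: poweR_ge0.
apply: leeD; apply: ereal_inf_lbound.
  exists (D `&` DF), B; split => //; last by move=> k [/Bt].
  move=> x Fx; have [k Dk Bkx] := FGB x (or_introl Fx).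
  by exists k => //; split => //; exists x.
exists (D `&` ~` DF), B; split => //; last by move=> k [/Bt].
move=> y Gy; have [k Dk Bky] := FGB y (or_intror Gy).
exists k => //; split => // -[x [Bkx Fx]].
have := Bt k Dk; apply/negP; rewrite -ltNge.
apply: (@lt_le_trans _ _ (enorm (x - y))%:E).
  rewrite lte_fin; apply: lt_le_trans (FG x y Fx Gy).
  by rewrite gt_min; apply/orP; right; rewrite ltr_pdivrMr// mulr_natr mulr2n ltrDl.
by apply: ereal_sup_ubound; exists x => //; exists y.
Qed.

Lemma hausdorff_separated (I : choiceType) (s : seq I) (F : I -> set 'rV[R]_n) d (e : R) :
  0 < e -> uniq s ->
  (forall i j x y, i != j -> F i x -> F j y -> e <= enorm (x - y)) ->
  (\sum_(i <- s) hausdorff_unnormalized d (F i) <=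
   hausdorff_unnormalized d (\big[setU/set0]_(i <- s) F i))%E.
Proof.
move=> e0 + sep; elim: s => [|i s IH] /=; first by rewrite !big_nil hausdorff_ge0.
move=> /andP[is_ us]; rewrite !big_cons.
apply: (@le_trans _ _ (hausdorff_unnormalized d (F i) +
    hausdorff_unnormalized d (\big[setU/set0]_(j <- s) F j))%E).
  by apply: leeD => //; exact: IH.
apply: (@hausdorff_separatedU _ e) => // x y Fx.
rewrite -(bigcup_seq s F) => -[j /= js Fy]; apply: (sep i j) => //.
by apply: contraNneq is_ => ->.
Qed.

Lemma hausdorff_lipschitz (f : 'rV[R]_n -> 'rV[R]_n) d (t : R) A : 0 < t -> 0 <= d ->
  (forall x y, enorm (f x - f y) <= t * enorm (x - y)) ->
  (hausdorff_unnormalized d (f @` A) <= (t `^ d)%:E * hausdorff_unnormalized d A)%E.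
Proof.
move=> t0 d0 ft; apply: ge_ereal_sup => _ [r /= r0 <-].
have td : 0 < t `^ d by exact: powR_gt0.
apply: (@le_trans _ _ ((t `^ d)%:E * hausdorff_content d (r / t) A)%E); last first.
  rewrite lee_pmul2l//; apply: ereal_sup_ubound; exists (r / t) => //=.
  exact: divr_gt0.
have dE B : (diam (f @` B) <= t%:E * diam B)%E.
  apply: ge_ereal_sup => _ [_ [x Bx <-] [_ [y By <-] <-]].
  apply: (@le_trans _ _ (t * enorm (x - y))%:E); first by rewrite lee_fin.
  rewrite EFinM lee_pmul2l//; apply: ereal_sup_ubound.
  by exists x => //; exists y.
have pE B : (poweR (diam (f @` B)) d <= (t `^ d)%:E * poweR (diam B) d)%E.
  (* The diameter -oo of the empty set has power 1 for d = 0 and power 0 otherwise. *)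
  have [->|/set0P[x Bx]] := eqVneq B set0.
    have -> : diam (f @` set0) = -oo%E.
      rewrite image_set0 /diam (_ : [set _ | _ in _ & _ in _] = set0) ?ereal_sup0//.
      by apply/seteqP; split => // z [].
    have [->|d1] := eqVneq d 0; last by rewrite poweRNyr// mule_ge0 ?lee_fin ?poweR_ge0// ltW.
    by rewrite !poweRe0 powRr0 mule1.
  have diam0 (C : set 'rV[R]_n) y : C y -> (0 <= diam C)%E.
    move=> Cy; apply: le_trans (_ : (enorm (y - y))%:E <= _)%E.
      by rewrite lee_fin sqrtr_ge0.
    by apply: ereal_sup_ubound; exists y => //; exists y.
  have B0 := diam0 _ _ Bx.
  rewrite -poweR_EFin -poweRM//; last by rewrite lee_fin ltW.
  apply: gt0_ler_poweR => //; rewrite ?in_itv/= ?leey ?andbT.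
  - by rewrite (diam0 _ (f x))//; exists x.
  - by rewrite mule_ge0// lee_fin ltW.
rewrite -lee_pdivrMl//; apply: le_ereal_inf_tmp => _ [D [B [AB Br ->]]].
rewrite lee_pdivrMl//; apply: (@le_trans _ _ (\esum_(k in D) poweR (diam (f @` B k)) d)%E).
  apply: ereal_inf_lbound; exists D, (fun k => f @` B k); split => //.
    by move=> _ [x /AB[k Dk Bx] <-]; exists k => //; exists x.
  move=> k Dk; apply: le_trans (dE _) _; rewrite -lee_pdivlMl//.
  by rewrite -EFinM mulrC; exact: Br.
apply: le_trans (_ : \esum_(k in D) ((t `^ d)%:E * poweR (diam (B k)) d) <= _)%E.
  by apply: le_esum => k _; exact: pE.
apply: ge_ereal_sup => _ [X DX <-]; rewrite -ge0_mule_fsumr; last by move=> k; exact: poweR_ge0.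
by rewrite lee_pmul2l//; apply: ereal_sup_ubound; exists X.
Qed.

End hausdorff.

(** * Hausdorff measure of coordinate flats in the cube *)

Section boxes.
Context (R : realType) (n : nat).
Implicit Types (a b c : 'I_n -> R) (i j : 'I_n).

Definition box a b : set 'rV[R]_n := [set x | forall j, a j <= x 0 j <= b j].

Lemma enorm_ge (x : 'rV[R]_n) i : `|x 0 i| <= enorm x.
Proof.
rewrite -sqrtr_sqr ler_wsqrtr// (bigD1 i)//= lerDl; apply: sumr_ge0 => j _.
exact: sqr_ge0.
Qed.

Lemma enorm_le (x : 'rV[R]_n) (l : R) : (forall i, `|x 0 i| <= l) ->
  enorm x <= n%:R * l.
Proof.
move=> xl; have [n0|n0] := posnP n.
  rewrite /enorm big1; first by rewrite sqrtr0 n0 mul0r.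
  by move=> i; exfalso; move: (leq_ltn_trans (leq0n i) (ltn_ord i)); rewrite n0.
have l0 : 0 <= l by apply: le_trans (xl (Ordinal n0)).
have nl0 : 0 <= n%:R * l by rewrite mulr_ge0.
rewrite -[leRHS]ger0_norm// -sqrtr_sqr ler_wsqrtr//.
apply: (@le_trans _ _ (\sum_(i < n) l ^+ 2)).
  by apply: ler_sum => i _; rewrite -[leLHS]real_normK ?num_real// lerXn2r ?nnegrE.
rewrite sumr_const card_ord -[leLHS]mulr_natl exprMn ler_wpM2r ?sqr_ge0//.
by rewrite -natrX ler_nat -mulnn leq_pmulr.
Qed.

Lemma diam_le (A : set 'rV[R]_n) (l : R) :
  (forall x y, A x -> A y -> forall i, `|x 0 i - y 0 i| <= l) ->
  (diam A <= (n%:R * l)%:E)%E.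
Proof.
move=> Al; apply: ge_ereal_sup => _ [x Ax [y Ay <-]].
by rewrite lee_fin; apply: enorm_le => i; rewrite !mxE; exact: Al.
Qed.

Lemma poweR_diam_le (A : set 'rV[R]_n) (l d : R) : 0 <= d -> 0 <= l ->
  (diam A <= l%:E)%E -> (poweR (diam A) d <= (l `^ d)%:E)%E.
Proof.
move=> d0 l0 Al; have [->|/set0P[x Ax]] := eqVneq A set0.
  have -> : diam (@set0 'rV[R]_n) = -oo%E.
    rewrite /diam (_ : [set _ | _ in _ & _ in _] = set0) ?ereal_sup0//.
    by apply/seteqP; split => // z [].
  have [->|d1] := eqVneq d 0; first by rewrite poweRe0 powRr0.
  by rewrite poweRNyr// lee_fin powR_ge0.
have A0 : (0 <= diam A)%E.
  apply: le_trans (_ : (enorm (x - x))%:E <= _)%E; first by rewrite lee_fin sqrtr_ge0.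
  by apply: ereal_sup_ubound; exists x => //; exists x.
rewrite -poweR_EFin; apply: gt0_ler_poweR => //; rewrite in_itv/= ?A0 ?leey//.
by rewrite lee_fin l0.
Qed.

(* J is the set of frozen coordinates. *)
Definition cube_flat (J : {set 'I_n}) c : set 'rV[R]_n :=
  [set x | (forall j, 0 <= x 0 j <= 1) /\ (forall j, j \in J -> x 0 j = c j)].

(** Cover by cells of side 1/N in the free coordinates. Each coordinate needs N + 1 indices because
    the value 1 has index N; the diameter is at most n times the side. *)
Lemma hausdorff_content_flat J c (d r : R) (N : nat) : 0 <= d -> (0 < N)%N ->
  n%:R / N%:R <= r ->
  (hausdorff_content d r (cube_flat J c) <=
   (N.+1%:R ^+ #|~: J| * (n%:R / N%:R) `^ d)%:E)%E.
Proof.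
move=> d0 N0 Nr; have N0' : 0 < N%:R :> R by rewrite ltr0n.
pose F (f : {ffun 'I_n -> 'I_N.+1}) : set 'rV[R]_n := [set x |
  (forall j, j \in J -> x 0 j = c j) /\
  (forall j, j \notin J -> (f j)%:R / N%:R <= x 0 j <= (f j).+1%:R / N%:R)].
(* Frozen coordinates get index 0, so that only the free ones are counted. *)
pose P := pffun_on (@ord0 N) (~: J) (predT : pred 'I_N.+1).
have nN0 : 0 <= n%:R / N%:R :> R by rewrite divr_ge0.
apply: le_trans (@hausdorff_content_cover _ _ _ P F d r _ _) _.
  move=> x [x01 xJ].
  exists [ffun j => if j \in J then ord0 else inord (Num.truncn (N%:R * x 0 j))].
    apply/pffun_onP; split => //; apply/supportP => j; rewrite inE negbK => jJ.
    by rewrite ffunE jJ.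
  split=> // j jJ; rewrite ffunE (negbTE jJ).
  have /andP[x0 x1] := x01 j.
  have Nx0 : 0 <= N%:R * x 0 j by rewrite mulr_ge0.
  have /andP[h1 h2] := truncn_itv Nx0.
  rewrite inordK; first by rewrite ler_pdivrMr// ler_pdivlMr// [x 0 j * _]mulrC h1 ltW.
  by rewrite ltnS -(ler_nat R) (le_trans h1)// -[leRHS]mulr1 ler_wpM2l.
apply: (@le_trans _ _ (\sum_(f in P) ((n%:R / N%:R) `^ d)%:E)%E).
  apply: lee_sum => f _.
  have dF : (diam (F f) <= (n%:R / N%:R)%:E)%E.
    apply: diam_le => x y [xJ x1] [yJ y1] j.
    have [jJ|jJ] := boolP (j \in J).
      by rewrite xJ// yJ// subrr normr0 invr_ge0 ltW.
    move: (x1 j jJ) (y1 j jJ); rewrite -natr1 mulrDl mul1r ler_norml => /andP[? ?] /andP[? ?].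
    apply/andP; split; lra.
  apply: le_trans (poweR_diam_le d0 nN0 dF).
  apply: hausdorff_content_diam; apply: le_trans dF _; by rewrite lee_fin.
rewrite sumEFin lee_fin sumr_const -[leLHS]mulr_natl ler_wpM2r ?powR_ge0//.
by rewrite card_pffun_on -natrX ler_nat card_ord.
Qed.

Lemma hausdorff_flat_lty J c :
  (hausdorff_unnormalized #|~: J|%:R (cube_flat J c) < +oo)%E.
Proof.
apply: (@le_lt_trans _ _ ((2 * n%:R) ^+ #|~: J|)%:E); last exact: ltry.
apply: ge_ereal_sup => _ [r /= r0 <-].
pose N := (Num.truncn (n%:R / r)).+1.
have N0 : 0 < N%:R :> R by rewrite ltr0n.
have h : n%:R / N%:R <= r.
  by rewrite ler_pdivrMr// -ler_pdivrMl// mulrC ltW// truncnS_gt.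
apply: le_trans (@hausdorff_content_flat J c _ r N _ _ h) _ => //.
rewrite lee_fin powR_mulrn ?divr_ge0// -exprMn lerXn2r ?nnegrE ?mulr_ge0 ?divr_ge0//.
rewrite mulrCA [leRHS]mulrC ler_wpM2l// ler_pdivrMr//.
by rewrite -natrM ler_nat mul2n -addnn -addn1 leq_add2l.
Qed.

(** With k free coordinates the covering bound is at most a constant times (n/N)^(d - k), which is
    small for large N. *)
Lemma hausdorff_flat_eq0 J c (d : R) : #|~: J|%:R < d ->
  hausdorff_unnormalized d (cube_flat J c) = 0%E.
Proof.
move=> Jd; apply/eqP; rewrite eq_le hausdorff_ge0 andbT.
have d0 : 0 <= d by apply: le_trans (ltW Jd).
apply: ge_ereal_sup => _ [r /= r0 <-]; apply/lee_addgt0Pr => e e0; rewrite add0e.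
set k := #|~: J| in Jd *.
have dk : 0 < d - k%:R by rewrite subr_gt0.
pose C : R := (2 * n.+1%:R) ^+ k.
have C0 : 0 < C by rewrite exprn_gt0// mulr_gt0.
(* Chosen such that C * t^(d - k) = e. *)
pose t := (e / C) `^ (d - k%:R)^-1.
have t0 : 0 < t by rewrite powR_gt0// divr_gt0.
pose m := Order.min r t.
have m0 : 0 < m by rewrite lt_min r0.
pose N := (Num.truncn (n%:R / m)).+1.
have N0 : 0 < N%:R :> R by rewrite ltr0n.
have h : n%:R / N%:R <= m.
  by rewrite ler_pdivrMr// -ler_pdivrMl// mulrC ltW// truncnS_gt.
apply: le_trans (@hausdorff_content_flat J c _ r N d0 _ _) _ => //.
  by apply: le_trans h _; rewrite ge_min lexx.
have q0 : 0 <= n%:R / N%:R :> R by rewrite divr_ge0.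
rewrite lee_fin.
have [qe|qn] := eqVneq (n%:R / N%:R : R) 0.
  rewrite qe powR0 ?mulr0 ?ltW// gt_eqF// (le_lt_trans _ Jd)//.
have q1 : 0 < n%:R / N%:R :> R by rewrite lt_neqAle eq_sym qn.
have -> : d = k%:R + (d - k%:R) by ring.
rewrite powRD; last by rewrite qn implybT.
rewrite powR_mulrn// mulrA -exprMn.
apply: (@le_trans _ _ (C * (e / C))); last by rewrite mulrC divfK// gt_eqF.
apply: ler_pM.
- by rewrite exprn_ge0// mulr_ge0.
- exact: powR_ge0.
- rewrite lerXn2r ?nnegrE ?mulr_ge0//.
  rewrite mulrCA [leRHS]mulrC; apply: ler_pM; rewrite ?ler_nat ?divr_ge0//.
  rewrite ler_pdivrMr// -natrM ler_nat mul2n -addnn -addn1 leq_add2l//.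
- apply: (@le_trans _ _ (t `^ (d - k%:R))).
    rewrite ge0_ler_powR ?nnegrE// ?(ltW dk) ?(ltW t0)//; apply: le_trans h _.
    by rewrite ge_min lexx orbT.
  by rewrite /t -powRrM mulVf ?gt_eqF// powRr1// ltW// divr_gt0.
Qed.

End boxes.

(** * Hausdorff measure of boxes in a hyperplane *)

Section face_boxes.
Context (R : realType) (n : nat).
Implicit Types (a b c : 'I_n -> R) (i j : 'I_n) (l : R).

Definition face_cube i c l : set 'rV[R]_n :=
  box c (fun j => c j + (j != i)%:R * l).

Definition kappa i : R :=
  fine (hausdorff_unnormalized n.-1%:R (face_cube i (fun=> 0) 1)).

Lemma cardsC1n i : #|~: [set i]| = n.-1.
Proof. by rewrite cardsC1 card_ord. Qed.

Lemma kappaE i : (kappa i)%:E = hausdorff_unnormalized n.-1%:R (face_cube i (fun=> 0) 1).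
Proof.
rewrite fineK// ge0_fin_numE ?hausdorff_ge0//.
apply: le_lt_trans (hausdorff_flat_lty [set i] (fun=> 0)).
rewrite cardsC1n; apply: le_hausdorff => x xi; split=> [j|j].
  have /andP[x0 x1] := xi j; rewrite x0 (le_trans x1)//.
  by rewrite add0r mulr1; case: (j != i).
by move: (xi j); rewrite inE => + ji; rewrite ji/= mul0r addr0 => /le_anti.
Qed.

Lemma kappa_ge0 i : 0 <= kappa i.
Proof. by apply: fine_ge0; exact: hausdorff_ge0. Qed.

(** A similarity of ratio l'/l, combined with the transposition of the coordinates i and i', maps
    one face onto the other. This is why one constant kappa serves all directions. *)
Lemma hausdorff_face_cube_le i i' c c' l l' : 0 < l -> 0 < l' ->
  (hausdorff_unnormalized n.-1%:R (face_cube i' c' l') <=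
   ((l' / l) ^+ n.-1)%:E * hausdorff_unnormalized n.-1%:R (face_cube i c l))%E.
Proof.
move=> l0 l'0; set t := l' / l; have t0 : 0 < t by exact: divr_gt0.
pose s := tperm i i'.
pose f (x : 'rV[R]_n) : 'rV[R]_n := \row_j (c' j + t * (x 0 (s j) - c (s j))).
have fl x y : enorm (f x - f y) <= t * enorm (x - y).
  have -> : t = Num.sqrt (t ^+ 2) by rewrite sqrtr_sqr ger0_norm// ltW.
  rewrite /enorm -sqrtrM ?sqr_ge0//.
  rewrite ler_wsqrtr// [leRHS]mulr_sumr [leRHS](reindex_inj (@perm_inj _ s)).
  by apply: ler_sum => j _; rewrite !mxE; nra.
rewrite -powR_mulrn ?(ltW t0)//.
apply: (@le_trans _ _ (hausdorff_unnormalized n.-1%:R (f @` face_cube i c l)));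
  last exact: hausdorff_lipschitz.
apply: le_hausdorff => y Hy.
exists (\row_j (c j + t^-1 * (y 0 (s j) - c' (s j)))); last first.
  apply/rowP => j; rewrite !mxE tpermK addrAC subrr add0r mulrA mulfV ?gt_eqF//.
  by rewrite mul1r addrC subrK.
move=> j; rewrite mxE.
have -> : (j != i) = (s j != i').
  rewrite /s; case: tpermP => [->|->|/eqP/negbTE -> /eqP/negbTE ->] //.
    by rewrite !eqxx.
  by rewrite eq_sym.
have /andP[y1 y2] := Hy (s j).
rewrite lerDl mulr_ge0 ?invr_ge0 ?(ltW t0)//= ?subr_ge0// lerD2l.
rewrite ler_pdivrMl//.
suff -> : t * ((s j != i')%:R * l) = (s j != i')%:R * l' by lra.
by rewrite mulrCA /t divfK// gt_eqF.
Qed.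

Lemma kappa_face i i' c : (kappa i)%:E = hausdorff_unnormalized n.-1%:R (face_cube i' c 1).
Proof.
rewrite kappaE; apply/eqP; rewrite eq_le; apply/andP; split.
  apply: le_trans (@hausdorff_face_cube_le i' i c _ 1 1 _ _) _ => //.
  by rewrite divr1 expr1n mul1e.
apply: le_trans (@hausdorff_face_cube_le i i' (fun=> 0) _ 1 1 _ _) _ => //.
by rewrite divr1 expr1n mul1e.
Qed.

(** This controls the excess when a box is covered by cubes of side e that stick out of it. *)
Lemma prodD_le (s : seq 'I_n) (P : pred 'I_n) (F : 'I_n -> R) :
  (forall j, P j -> 0 <= F j) -> exists2 C : R, 0 <= C &
    forall e : R, 0 <= e <= 1 ->
      \prod_(j <- s | P j) (F j + e) <= \prod_(j <- s | P j) F j + C * e.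
Proof.
move=> F0; elim: s => [|j s [C C0 IH]].
  by exists 0 => // e _; rewrite !big_nil mul0r addr0.
have [Pj|Pj] := boolP (P j); last first.
  by exists C => // e e01; rewrite !big_cons (negbTE Pj); exact: IH.
have p0 : 0 <= \prod_(j <- s | P j) F j by apply: prodr_ge0.
(* Expanding (F j + e) * (P + C * e), where P is the remaining product, and using e^2 <= e. *)
exists ((F j + 1) * C + \prod_(j <- s | P j) F j).
  by rewrite addr_ge0// mulr_ge0// addr_ge0 ?F0.
move=> e /andP[e0 e1]; rewrite !big_cons Pj.
have e01 : 0 <= e <= 1 by rewrite e0.
apply: (@le_trans _ _ ((F j + e) * (\prod_(j <- s | P j) F j + C * e))).
  by rewrite ler_wpM2l ?IH// addr_ge0 ?F0.
have : 0 <= C * e * (1 - e) by rewrite !mulr_ge0// subr_ge0.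
by lra.
Qed.

(* The box is covered by translates of the cube of side 1/N. *)
Lemma hausdorff_box_le i0 i a b : a i = b i -> (forall j, a j <= b j) ->
  (hausdorff_unnormalized n.-1%:R (box a b) <=
   (kappa i0 * \prod_(j | j != i) (b j - a j))%:E)%E.
Proof.
move=> abi ab.
have ab0 j : 0 <= b j - a j by rewrite subr_ge0.
have [C C0 HC] := prodD_le (index_enum _) (fun j (_ : j != i) => ab0 j).
suff H N : (0 < N)%N -> (hausdorff_unnormalized n.-1%:R (box a b) <=
    (kappa i0 * \prod_(j | j != i) (b j - a j + N%:R^-1))%:E)%E.
  apply/lee_addgt0Pr => e e0.
  pose N := (Num.truncn (kappa i0 * C / e)).+1.
  have N0 : 0 < N%:R :> R by rewrite ltr0n.
  apply: le_trans (H N _) _ => //; rewrite lee_fin.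
  have N1 : (0 <= (N%:R^-1 : R)) && ((N%:R^-1 : R) <= 1).
    by rewrite invr_ge0 (ltW N0)/= invf_le1// ler1n.
  apply: (@le_trans _ _ (kappa i0 * (\prod_(j | j != i) (b j - a j) + C * N%:R^-1))).
    by rewrite ler_wpM2l ?kappa_ge0 ?HC.
  rewrite mulrDr lerD2l mulrA ler_pdivrMr// [e * _]mulrC -ler_pdivrMr//.
  by rewrite ltW// truncnS_gt.
move=> N0; have NR : 0 < N%:R :> R by rewrite ltr0n.
pose m j := Num.truncn (N%:R * (b j - a j)).
(* A common bound on the numbers of cubes, so that one finite type indexes the cover; [Q] restores
   the range of each direction. *)
pose L := \max_j m j.
pose F (f : {ffun 'I_n -> 'I_L.+1}) :=
  face_cube i (fun j => a j + (f j)%:R / N%:R) N%:R^-1.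
pose Q j : pred 'I_L.+1 := fun r => (r <= m j)%N.
have mi0 : m i = 0%N by rewrite /m abi subrr mulr0 truncn0.
apply: le_trans (@hausdorff_cover _ _ _ (mem (family Q)) F _ _ _) _.
  move=> x abx.
  have xa0 j : 0 <= N%:R * (x 0 j - a j).
    by rewrite mulr_ge0 ?subr_ge0//; case/andP: (abx j).
  have trm j : (Num.truncn (N%:R * (x 0 j - a j))%R <= m j)%N.
    apply: le_truncn; rewrite ler_wpM2l// lerD2r; by case/andP: (abx j).
  exists [ffun j => inord (Num.truncn (N%:R * (x 0 j - a j)))].
    apply/familyP => j; rewrite ffunE /Q unfold_in inordK//.
    by rewrite ltnS (leq_trans (trm j))// leq_bigmax.
  move=> j; rewrite ffunE inordK; last by rewrite ltnS (leq_trans (trm j))// leq_bigmax.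
  have /andP[h1 h2] := truncn_itv (xa0 j).
  have [->|ji]/= := eqVneq j i.
    have := trm i; rewrite mi0 leqn0 => /eqP ->.
    by rewrite !mul0r !addr0 {2}abi; exact: abx.
  rewrite -lerBrDl ler_pdivrMr// [_ * N%:R]mulrC h1/= -addrA -lerBlDl.
  by rewrite -mulrDl natr1 ler_pdivlMr// mulrC ltW.
apply: (@le_trans _ _ (\sum_(f in family Q) (kappa i0 * \prod_(j | j != i) N%:R^-1)%:E)%E).
  apply: lee_sum => f _.
  apply: le_trans (@hausdorff_face_cube_le i0 i (fun=> 0) _ 1 _ _ _) _ => //.
    by rewrite invr_gt0.
  rewrite -kappaE -EFinM lee_fin divr1 mulrC prodr_const.
  by rewrite (_ : #|_| = n.-1)// -(cardsC1n i); apply: eq_card => j; rewrite !inE.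
rewrite sumEFin lee_fin.
(* The constant kappa is put into slot i, where only one index is allowed; the sum over the cover
   then factors into a product of sums. *)
pose G j (r : 'I_L.+1) : R := if j == i then kappa i0 else N%:R^-1.
rewrite (eq_bigr (fun f : {ffun 'I_n -> 'I_L.+1} => \prod_j G j (f j))); last first.
  move=> f _; rewrite [RHS](bigD1 i)//= {1}/G eqxx; congr (_ * _).
  by apply: eq_bigr => j ji; rewrite /G (negbTE ji).
rewrite -(bigA_distr_big_dep Q G) (bigD1 i)//=.
have cQ j : #|Q j| = (m j).+1.
  have mL : ((m j).+1 <= L.+1)%N by rewrite ltnS leq_bigmax.
  have wI : injective (widen_ord mL) by move=> r r' /(congr1 val) /= /val_inj.
  rewrite -[RHS]card_ord -(fintype.card_image wI predT).
  apply: eq_card => r; apply/idP/fintype.imageP => [rm|[q _ ->]]; last exact: (ltn_ord q).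
  by exists (Ordinal (rm : (r < (m j).+1)%N)) => //; exact: val_inj.
apply: ler_pM.
- by apply: sumr_ge0 => r _; rewrite /G eqxx kappa_ge0.
- by apply: prodr_ge0 => j ji; apply: sumr_ge0 => r _; rewrite /G (negbTE ji) invr_ge0.
- by rewrite /G eqxx sumr_const cQ mi0.
apply: ler_prod => j ji; rewrite /G (negbTE ji) sumr_const cQ.
rewrite mulrn_wge0 ?invr_ge0//=.
rewrite -[leLHS]mulr_natl -natr1 mulrDl mul1r lerD2r ler_pdivrMr// mulrC.
by rewrite truncn_le mulr_ge0.
Qed.

End face_boxes.

(** * Volume *)

Section volume.
Context (R : realType).

Definition rV_measurable n (A : set 'rV[R]_n) : Prop :=
  measurable [set t : n.-tuple (measurableTypeR R) | A (\row_i tnth t i)].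

Lemma rV_measurableI n (A B : set 'rV[R]_n) : rV_measurable A -> rV_measurable B ->
  rV_measurable (A `&` B).
Proof. exact: measurableI. Qed.

Lemma rV_measurableU n (A B : set 'rV[R]_n) : rV_measurable A -> rV_measurable B ->
  rV_measurable (A `|` B).
Proof. exact: measurableU. Qed.

Lemma rV_measurable_prod n (J : 'I_n -> set R) :
  (forall i, measurable (J i : set (measurableTypeR R))) ->
  rV_measurable [set x | forall i, J i (x 0 i)].
Proof.
move=> mJ; rewrite /rV_measurable.
rewrite (_ : mkset _ = \bigcap_(i in [set: 'I_n])
    ((fun t : n.-tuple (measurableTypeR R) => tnth t i) @^-1` J i)).
  apply: fin_bigcap_measurable => [|i _]; first exact: finite_finset.
  rewrite -[X in measurable X]setTI.
  by apply: measurable_tnth.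
apply/seteqP; split => [t /= tJ i _ /=|t tJ i].
  by move: (tJ i); rewrite mxE.
by rewrite mxE; exact: tJ.
Qed.

Lemma Vol_prod n (J : 'I_n -> set R) :
  (forall i, measurable (J i : set (measurableTypeR R))) ->
  Vol [set x | forall i, J i (x 0 i)] = (\prod_i (@lebesgue_measure R (J i)))%E.
Proof.
elim: n J => [|n IH] J mJ.
  rewrite /Vol /= diracE big_ord0 mem_set//=.
  by case.
rewrite big_ord_recl -IH//.
rewrite -product_measure1E//; last exact: (rV_measurable_prod (fun i => mJ (lift ord0 i))).
rewrite [LHS]/Vol /= /lebesgue_step /pushforward; congr (_ _).
apply/seteqP; split => [[x t] /= Jt|[x t] /= [Jx Jt] i].
  split=> [|i]; first by move: (Jt ord0); rewrite mxE.
  by move: (Jt (lift ord0 i)); rewrite !mxE tnthS.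
rewrite mxE; case: (unliftP ord0 i) => [j ->|-> //].
by move: (Jt j); rewrite mxE tnthS.
Qed.

Lemma Vol_ge0 n (A : set 'rV[R]_n) : (0 <= Vol A)%E.
Proof. exact: measure_ge0. Qed.

Lemma le_Vol n (A B : set 'rV[R]_n) : rV_measurable A -> rV_measurable B -> A `<=` B ->
  (Vol A <= Vol B)%E.
Proof. by move=> mA mB AB; apply: le_measure; rewrite ?inE// => t; exact: AB. Qed.

Lemma Vol0 n : Vol (@set0 'rV[R]_n) = 0%E.
Proof. exact: measure0. Qed.

Lemma VolU n (A B : set 'rV[R]_n) : rV_measurable A -> rV_measurable B -> A `&` B = set0 ->
  Vol (A `|` B) = (Vol A + Vol B)%E.
Proof.
move=> mA mB AB; apply: measureU => //; apply/seteqP; split=> // t /= ABt.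
by have : (A `&` B) (\row_i tnth t i) by []; rewrite AB.
Qed.

Lemma VolU_le n (A B : set 'rV[R]_n) : rV_measurable A -> rV_measurable B ->
  (Vol (A `|` B) <= Vol A + Vol B)%E.
Proof. exact: measureU2. Qed.

Lemma rV_measurable0 n : rV_measurable (@set0 'rV[R]_n).
Proof. exact: measurable0. Qed.

Lemma rV_measurable_bigU n (I : Type) (s : seq I) (P : pred I) (F : I -> set 'rV[R]_n) :
  (forall i, rV_measurable (F i)) -> rV_measurable (\big[setU/set0]_(i <- s | P i) F i).
Proof.
move=> mF; elim/big_ind: _ => [|A B|i _]; [exact: rV_measurable0|exact: rV_measurableU|exact: mF].
Qed.

Lemma Vol_cover n (I : finType) (P : pred I) (F : I -> set 'rV[R]_n) A :
  rV_measurable A -> (forall i, rV_measurable (F i)) ->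
  (forall x, A x -> exists2 i, P i & F i x) -> (Vol A <= \sum_(i | P i) Vol (F i))%E.
Proof.
move=> mA mF AF; apply: (@le_trans _ _ (Vol (\big[setU/set0]_(i | P i) F i))).
  apply: le_Vol => //; first exact: rV_measurable_bigU.
  move=> x /AF[i Pi Fi]; rewrite -bigcup_seq_cond.
  by exists i => //=; rewrite mem_index_enum.
elim: (index_enum I) => [|i s IH]; first by rewrite !big_nil Vol0.
rewrite !big_cons; case: ifP => // _.
by apply: le_trans (VolU_le _ _) _; [exact: mF|exact: rV_measurable_bigU|exact: leeD].
Qed.

Lemma Vol_disjoint n (I : finType) (P : pred I) (F : I -> set 'rV[R]_n) A :
  rV_measurable A -> (forall i, rV_measurable (F i)) ->
  (forall i, P i -> F i `<=` A) ->
  (forall i j x, F i x -> F j x -> i = j) -> (\sum_(i | P i) Vol (F i) <= Vol A)%E.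
Proof.
move=> mA mF FA disj.
apply: (@le_trans _ _ (Vol (\big[setU/set0]_(i | P i) F i))); last first.
  apply: le_Vol => //; first exact: rV_measurable_bigU.
  by move=> x; rewrite -bigcup_seq_cond => -[i /andP[_ Pi]]; exact: FA.
elim: (index_enum I) (index_enum_uniq I) => [|i s IH] /=; first by rewrite !big_nil Vol0.
move=> /andP[is_ us]; rewrite !big_cons; case: ifP => Pi; last exact: IH.
rewrite VolU; [|exact: mF|exact: rV_measurable_bigU|].
  by apply: leeD => //; exact: IH.
apply/seteqP; split => // x [Fix]; rewrite -bigcup_seq_cond => -[j /andP[/= js _] Fjx].
by rewrite (disj _ _ _ Fix Fjx) js in is_.
Qed.

Definition obox n (a b : 'I_n -> R) : set 'rV[R]_n :=
  [set x | forall j, a j < x 0 j < b j].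

Lemma boxE n (a b : 'I_n -> R) :
  box a b = [set x | forall j, [set` `[a j, b j]] (x 0 j)].
Proof. by apply/seteqP; split => x xab j; move: (xab j); rewrite /= in_itv. Qed.

Lemma oboxE n (a b : 'I_n -> R) :
  obox a b = [set x | forall j, [set` `]a j, b j[] (x 0 j)].
Proof. by apply/seteqP; split => x xab j; move: (xab j); rewrite /= in_itv. Qed.

Lemma rV_measurable_box n (a b : 'I_n -> R) : rV_measurable (box a b).
Proof. by rewrite boxE; apply: (rV_measurable_prod (J :=
  fun j => [set` `[a j, b j]])) => i; exact: measurable_itv. Qed.

Lemma rV_measurable_obox n (a b : 'I_n -> R) : rV_measurable (obox a b).
Proof. by rewrite oboxE; apply: (rV_measurable_prod (J :=
  fun j => [set` `]a j, b j[])) => i; exact: measurable_itv. Qed.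

Lemma Vol_box n (a b : 'I_n -> R) : (forall j, a j <= b j) ->
  Vol (box a b) = (\prod_j (b j - a j))%:E.
Proof.
move=> ab; rewrite boxE (Vol_prod (J := fun j => [set` `[a j, b j]])) => [|i];
  last exact: measurable_itv.
rewrite -prodEFin; apply: eq_bigr => j _.
rewrite lebesgue_measure_itv/= lte_fin lt_neqAle ab andbT.
by case: eqP => // ->; rewrite subrr.
Qed.

Lemma Vol_obox n (a b : 'I_n -> R) : (forall j, a j <= b j) ->
  Vol (obox a b) = (\prod_j (b j - a j))%:E.
Proof.
move=> ab; rewrite oboxE (Vol_prod (J := fun j => [set` `]a j, b j[])) => [|i];
  last exact: measurable_itv.
rewrite -prodEFin; apply: eq_bigr => j _.
rewrite lebesgue_measure_itv/= lte_fin lt_neqAle ab andbT.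
by case: eqP => // ->; rewrite subrr.
Qed.

Lemma nbhs_rowP n (x : 'rV[R]_n) (P : set 'rV[R]_n) :
  nbhs x P <-> exists2 e : R, 0 < e & forall y : 'rV[R]_n, (forall i, `|x 0 i - y 0 i| < e) -> P y.
Proof.
split=> [/nbhs_ballP[e /= e0 eP]|[e e0 eP]].
  exists e => // y xy; apply: eP; split => // i j.
  by rewrite (ord1 i); exact: xy.
apply/nbhs_ballP; exists e => //= y [_ xy]; apply: eP => i; exact: xy.
Qed.

(** A closed set is the intersection, over all N, of the finite unions of those closed cells of side
    1/(N+1) that meet it. *)
Lemma rV_measurable_closed n (X : set 'rV[R]_n) : closed X -> X `<=` @unit_cube R n ->
  rV_measurable X.
Proof.
move=> clX Xcube.
pose F N (f : {ffun 'I_n -> 'I_N.+2}) :=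
  @box R n (fun j => (f j)%:R / N.+1%:R) (fun j => (f j).+1%:R / N.+1%:R).
pose G N := \big[setU/set0]_(f | `[< X `&` F N f !=set0 >]) F N f.
have -> : X = \bigcap_N G N.
  apply/seteqP; split => [x Xx N _|x Gx].
    have NR : 0 < N.+1%:R :> R by rewrite ltr0n.
    have xf : F N [ffun j => inord (Num.truncn (N.+1%:R * x 0 j))] x.
      move=> j; have /andP[x0 x1] := Xcube x Xx j.
      have Nx0 : 0 <= N.+1%:R * x 0 j by rewrite mulr_ge0.
      have /andP[h1 h2] := truncn_itv Nx0.
      rewrite ffunE inordK; first by rewrite ler_pdivrMr// ler_pdivlMr// [x 0 j * _]mulrC h1 ltW.
      by rewrite ltnS -(ler_nat R) (le_trans h1)// -[leRHS]mulr1 ler_wpM2l.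
    rewrite /G -bigcup_seq_cond; eexists; last exact: xf.
    by rewrite /= mem_index_enum/=; apply/asboolP; exists x.
  move/closure_id : clX => ->; move=> B /nbhs_rowP[e e0 eB].
  have [N Ne] : exists N, (N.+1%:R : R)^-1 < e.
    by exists (Num.truncn e^-1); rewrite invf_plt ?posrE// truncnS_gt.
  have := Gx N I; rewrite /G -bigcup_seq_cond => -[f /andP[_ /asboolP[y [Xy Fy]]] Fx].
  exists y; split => //; apply: eB => j.
  have NR : 0 < N.+1%:R :> R by rewrite ltr0n.
  suff gap (k : nat) (u v : R) : k%:R / N.+1%:R <= u <= k.+1%:R / N.+1%:R ->
      k%:R / N.+1%:R <= v <= k.+1%:R / N.+1%:R -> `|u - v| < e.
    exact: gap (Fx j) (Fy j).
  move: Ne; rewrite -[k.+1%:R]natr1 mulrDl mul1r.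
  move: (_ / _) => p; move: (_^-1) => q ? /andP[? ?] /andP[? ?].
  rewrite ltr_norml; apply/andP; split; lra.
rewrite /rV_measurable (_ : mkset _ = \bigcap_N
    [set t : n.-tuple (measurableTypeR R) | G N (\row_i tnth t i)])//.
apply: bigcap_measurableType => N _.
by apply: rV_measurable_bigU => f; exact: rV_measurable_box.
Qed.

Lemma rV_measurable_eball n (x : 'rV[R]_n) (r : R) : 0 < r -> rV_measurable (eball x r).
Proof.
move=> r0; rewrite /rV_measurable.
pose h (t : n.-tuple (measurableTypeR R)) : R := \sum_i (tnth t i - x 0 i) ^+ 2.
rewrite (_ : mkset _ = h @^-1` `]-oo, r ^+ 2[%classic); last first.
  apply/seteqP; split => t /=; rewrite in_itv/= /eball/= /enorm.
    under eq_bigr do rewrite !mxE.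
    move=> tr; have h0 : 0 <= h t by apply: sumr_ge0 => i _; exact: sqr_ge0.
    by rewrite -(sqr_sqrtr h0) ltrXn2r// ?nnegrE ?sqrtr_ge0// ltW.
  under eq_bigr do rewrite !mxE.
  move=> hr; rewrite -[ltRHS]ger0_norm ?ltW// -sqrtr_sqr ltr_sqrt//.
  by rewrite exprn_gt0.
rewrite -[X in measurable X]setTI.
have mh : measurable_fun setT h; last by apply: mh => //; exact: measurable_itv.
apply: measurable_sum => i.
apply: measurable_funX; apply: measurable_funB => //.
exact: measurable_tnth.
Qed.

End volume.

(** * Densities and the essential boundary *)

Section density.
Context (R : realType) (n : nat) (n_gt0 : (0 < n)%N).
Implicit Types (x y : 'rV[R]_n) (X : set 'rV[R]_n) (r e : R) (i j : 'I_n).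

Let nR : 0 < n%:R :> R. Proof. by rewrite ltr0n. Qed.

(** Half side of a cube inside the ball of radius r: the Euclidean norm is at most n times the sup
    norm, and the factor 2 makes the inclusion strict. *)
Let eta r := r / (2 * n%:R).

Let eta_gt0 r : 0 < r -> 0 < eta r.
Proof. by move=> r0; rewrite divr_gt0// mulr_gt0. Qed.

Lemma box_sub_eball x r : 0 < r ->
  box (fun j => x 0 j - eta r) (fun j => x 0 j + eta r) `<=` eball x r.
Proof.
move=> r0 y xy; apply: (@le_lt_trans _ _ (n%:R * eta r)).
  apply: enorm_le => j; rewrite !mxE ler_norml.
  by move: (xy j) => /andP[? ?]; apply/andP; split; lra.
have -> : n%:R * eta r = r / 2 by rewrite /eta; field; rewrite gt_eqF.
by rewrite ltr_pdivrMr// mulr_natr mulr2n ltrDl.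
Qed.

Lemma eball_sub_box x r :
  eball x r `<=` box (fun j => x 0 j - r) (fun j => x 0 j + r).
Proof.
move=> y xy j; have := le_lt_trans (enorm_ge (y - x) j) xy.
by rewrite !mxE ltr_norml => /andP[? ?]; apply/andP; split; lra.
Qed.

Lemma Vol_eball_lty x r : 0 < r -> (Vol (eball x r) < +oo)%E.
Proof.
move=> r0; apply: le_lt_trans (le_Vol (rV_measurable_eball _ _)
  (rV_measurable_box _ _) (@eball_sub_box x r)) _ => //.
by rewrite Vol_box ?ltry// => j; lra.
Qed.

Lemma Vol_eball_gt0 x r : 0 < r -> (0 < Vol (eball x r))%E.
Proof.
move=> r0; have e0 := eta_gt0 r0.
apply: lt_le_trans (le_Vol (rV_measurable_box _ _)
  (rV_measurable_eball _ _) (box_sub_eball r0)) => //.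
rewrite Vol_box => [|j]; last by lra.
by rewrite lte_fin; apply: prodr_gt0 => j _; lra.
Qed.

Lemma Vol_eballE x r : 0 < r ->
  ((fine (Vol (eball x r)))%:E = Vol (eball x r))%E.
Proof. by move=> r0; rewrite fineK// ge0_fin_numE ?Vol_ge0// Vol_eball_lty. Qed.

Lemma density_in X x : nbhs x X -> has_density X 1 x.
Proof.
move=> /nbhs_rowP[e e0 eX]; apply: cvg_near_cst.
near=> r; have r0 : 0 < r by near: r; exact: nbhs_right_gt.
have -> : X `&` eball x r = eball x r.
  apply/seteqP; split => [y []//|y xy]; split => //; apply: eX => j.
  rewrite distrC; apply: (@lt_trans _ _ r); last by near: r; exact: nbhs_right_lt.
  by have := le_lt_trans (enorm_ge (y - x) j) xy; rewrite !mxE.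
by rewrite divff// gt_eqF// -lte_fin Vol_eballE// Vol_eball_gt0.
Unshelve. all: by end_near. Qed.

Lemma density_out X x : nbhs x (~` X) -> has_density X 0 x.
Proof.
move=> /nbhs_rowP[e e0 eX]; apply: cvg_near_cst.
near=> r; have r0 : 0 < r by near: r; exact: nbhs_right_gt.
have -> : X `&` eball x r = set0.
  apply/seteqP; split => [y [Xy xy]|//]; apply: (eX y) => // j.
  rewrite distrC; apply: (@lt_trans _ _ r); last by near: r; exact: nbhs_right_lt.
  by have := le_lt_trans (enorm_ge (y - x) j) xy; rewrite !mxE.
by rewrite Vol0 mul0r.
Unshelve. all: by end_near. Qed.

Lemma essential_boundary_sub X : essential_boundary X `<=` boundary X.
Proof.
move=> x [x0 x1]; split; last by move=> /density_in.
apply: contrapT => clx; apply: x0; apply: density_out.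
apply: contrapT => nx; apply: clx => B xB; apply: contrapT => XB.
apply: nx; apply: filterS xB => y By Xy; apply: XB; by exists y.
Qed.

(* Up to a factor depending on n only, the two half boxes of side eta r
   at x have the volume of the ball of radius r. *)
Let halfbox x r i (b : bool) : set 'rV[R]_n := obox
  (fun j => if (j == i) && b then x 0 j else x 0 j - eta r)
  (fun j => if (j == i) && ~~ b then x 0 j else x 0 j + eta r).

(** This is (eta r / (2r))^n: a half box has all sides at least [eta r], and the ball lies in a cube
    of side 2r. *)
Let ratio : R := (n%:R * 4)^-1 ^+ n.

Let Vol_halfbox x r i b : 0 < r ->
  ((ratio * fine (Vol (eball x r)))%:E <= Vol (halfbox x r i b))%E.
Proof.
move=> r0; have e0 := eta_gt0 r0.
rewrite Vol_obox => [|j]; last by case: eqP => _; case: b => /=; lra.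
rewrite lee_fin; apply: (@le_trans _ _ (ratio * (2 * r) ^+ n)).
  rewrite ler_wpM2l ?exprn_ge0 ?invr_ge0 ?mulr_ge0//.
  rewrite -lee_fin Vol_eballE//.
  apply: le_trans (le_Vol (rV_measurable_eball _ _)
    (rV_measurable_box _ _) (@eball_sub_box x r)) _ => //.
  rewrite Vol_box => [|j]; last by lra.
  rewrite lee_fin (eq_bigr (fun=> 2 * r)) => [|j _]; last by ring.
  by rewrite prodr_const card_ord.
rewrite /ratio -exprMn -[X in _ ^+ X]card_ord -prodr_const.
have -> : (n%:R * 4)^-1 * (2 * r) = eta r.
  by rewrite /eta; field; rewrite gt_eqF.
apply: ler_prod => j _; rewrite (ltW e0)/=.
by case: eqP => _; case: b => /=; lra.
Qed.

Let halfbox_sub x r i b : 0 < r -> halfbox x r i b `<=` eball x r.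
Proof.
move=> r0 y xy; have e0 := eta_gt0 r0; apply: box_sub_eball => // j.
move: (xy j); case: eqP => _; case: b {xy} => /= /andP[? ?]; apply/andP; split; lra.
Qed.

(** Of every small ball a fixed fraction lies in X on one side of the hyperplane and outside X on
    the other, so the density quotient stays between [ratio] and 1 - [ratio]. *)
Lemma essential_boundary_jump X x i e b : rV_measurable X -> 0 < e ->
  (forall y, (forall j, `|x 0 j - y 0 j| < e) -> y 0 i != x 0 i ->
    X y <-> (x 0 i < y 0 i) = b) ->
  essential_boundary X x.
Proof.
move=> mX e0 HX.
have ratio0 : 0 < ratio by rewrite exprn_gt0// invr_gt0 mulr_gt0.
have H r : 0 < r -> r < e -> ratio <= fine (Vol (X `&` eball x r))
  / fine (Vol (eball x r)) <= 1 - ratio.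
  move=> r0 re; have B0 : 0 < fine (Vol (eball x r)) by rewrite -lte_fin Vol_eballE// Vol_eball_gt0.
  have mB := rV_measurable_eball x r0.
  have VXB : ((fine (Vol (X `&` eball x r)))%:E = Vol (X `&` eball x r))%E.
    rewrite fineK// ge0_fin_numE ?Vol_ge0//.
    apply: le_lt_trans (Vol_eball_lty x r0); apply: le_Vol => //.
    exact: rV_measurableI.
  have near_x y b' : halfbox x r i b' y ->
    (forall j, `|x 0 j - y 0 j| < e) /\ y 0 i != x 0 i /\ (x 0 i < y 0 i) = b'.
    move=> xy; split.
      move=> j; rewrite distrC; apply: lt_trans re.
      by have := le_lt_trans (enorm_ge (y - x) j) (halfbox_sub r0 xy); rewrite !mxE.
    move: (xy i); rewrite eqxx /=; case: b' {xy} => /= /andP[x1 x2].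
      by rewrite gt_eqF ?x1.
    by rewrite lt_eqF// ltNge ltW.
  rewrite ler_pdivlMr// ler_pdivrMr//; apply/andP; split.
    rewrite -lee_fin VXB; apply: le_trans (Vol_halfbox _ i b r0) _.
    apply: le_Vol; [exact: rV_measurable_obox|exact: rV_measurableI|].
    move=> y xy; split; last exact: halfbox_sub xy.
    have [h1 [h2 h3]] := near_x _ _ xy; exact/(HX _ h1 h2).
  rewrite mulrBl mul1r lerBrDr -lee_fin EFinD VXB.
  apply: (@le_trans _ _ (Vol (X `&` eball x r) + Vol (halfbox x r i (~~ b)))%E).
    by apply: leeD => //; exact: Vol_halfbox.
  rewrite Vol_eballE// -VolU; [|exact: rV_measurableI|exact: rV_measurable_obox|].
    apply: le_Vol => //; first by apply: rV_measurableU;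
      [exact: rV_measurableI|exact: rV_measurable_obox].
    by move=> y [[]//|]; exact: halfbox_sub.
  apply/seteqP; split => // y [[Xy _] xy].
  have [h1 [h2 h3]] := near_x _ _ xy.
  by move/(HX _ h1 h2) : Xy; rewrite h3; case: (b).
split=> cX.
  have H0 : \forall r \near 0^'+,
      fine (Vol (X `&` eball x r)) / fine (Vol (eball x r)) < ratio.
    exact: (cvgr_lt 0).
  have : \forall r \near (0:R)^'+, False; last by move/filter_ex => [].
  near=> r; have /andP[+ _] : ratio <= fine (Vol (X `&` eball x r))
    / fine (Vol (eball x r)) <= 1 - ratio.
    by apply: H; near: r; [exact: nbhs_right_gt|exact: nbhs_right_lt].
  by apply/negP; rewrite -ltNge; near: r.
have H0 : \forall r \near 0^'+,
    1 - ratio < fine (Vol (X `&` eball x r)) / fine (Vol (eball x r)).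
  by apply: (cvgr_gt 1) => //; lra.
have : \forall r \near (0:R)^'+, False; last by move/filter_ex => [].
near=> r; have /andP[_] : ratio <= fine (Vol (X `&` eball x r)) / fine (Vol (eball x r))
  <= 1 - ratio.
  by apply: H; near: r; [exact: nbhs_right_gt|exact: nbhs_right_lt].
by apply/negP; rewrite -ltNge; near: r.
Unshelve. all: by end_near. Qed.

End density.

(** * Open and closed boxes *)

Section cells.
Context (R : realType) (n : nat).
Implicit Types (x y : 'rV[R]_n) (X : set 'rV[R]_n) (a b : 'I_n -> R).

Lemma obox_open a b x : obox a b x -> nbhs x (obox a b).
Proof.
move=> xab; apply/nbhs_rowP.
pose e j := Order.min (x 0 j - a j) (b j - x 0 j).
exists (\big[Order.min/1]_j e j).
  apply: lt_bigmin => // j _; have /andP[? ?] := xab j.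
  by rewrite lt_min !subr_gt0; apply/andP.
move=> y xy j; have : `|x 0 j - y 0 j| < e j.
  by apply: lt_le_trans (xy j) _; exact: bigmin_le.
rewrite lt_min => /andP[]; rewrite !ltr_norml => /andP[? ?] /andP[? ?].
by apply/andP; split; lra.
Qed.

Lemma box_closed a b : closed (@box R n a b).
Proof.
move=> x clx j; apply/andP; split; rewrite leNgt; apply/negP => xj.
  have [|y [yab xy]] := clx [set y | forall i, `|x 0 i - y 0 i| < a j - x 0 j].
    by apply/nbhs_rowP; exists (a j - x 0 j) => //; rewrite subr_gt0.
  move: (xy j) (yab j); rewrite ltr_norml => /andP[? ?] /andP[? ?]; lra.
have [|y [yab xy]] := clx [set y | forall i, `|x 0 i - y 0 i| < x 0 j - b j].
  by apply/nbhs_rowP; exists (x 0 j - b j) => //; rewrite subr_gt0.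
move: (xy j) (yab j); rewrite ltr_norml => /andP[? ?] /andP[? ?]; lra.
Qed.

(** Along the segment from x to y the closed set X agrees with its interior, so it is clopen there,
    and a segment is connected. *)
Lemma obox_connected X a b x y : closed X -> boundary X `&` obox a b = set0 ->
  obox a b x -> obox a b y -> X x -> X y.
Proof.
move=> clX bX xab yab Xx.
pose f (t : R) : 'rV[R]_n := x + t *: (y - x).
have cf : continuous f.
  by move=> t; apply: cvgD; [exact: cvg_cst|apply: cvgZr_tmp; exact: cvg_id].
have fab t : t \in `[0, 1]%R -> obox a b (f t).
  rewrite in_itv/= => /andP[t0 t1] j; rewrite !mxE.
  have /andP[? ?] := xab j; have /andP[? ?] := yab j.
  have [t00|t00] := eqVneq t 0; first by rewrite t00 mul0r addr0; apply/andP.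
  have tp : 0 < t by rewrite lt_neqAle eq_sym t00.
  apply/andP; split; nra.
have iX z : obox a b z -> X z -> X° z.
  move=> zab Xz; apply: contrapT => iz.
  have : (boundary X `&` obox a b) z by split => //; split => //; exact: subset_closure.
  by rewrite bX.
have := @segment_connected R 0 1 (`[0, 1]%classic `&` f @^-1` X).
have -> : `[0, 1]%classic `&` f @^-1` X = `[0, 1]%classic `&` f @^-1` X° .
  apply/seteqP; split => t [t01 Xt]; split => //; last exact: (interior_subset Xt).
  by apply: iX => //; exact: fab.
move=> H.
have : (`[0, 1]%classic `&` f @^-1` X°) 1.
  rewrite H /=; [by rewrite in_itv/= ler01 lexx|..].
  - exists 0; split; first by rewrite /= in_itv/= lexx ler01.
    by rewrite /= /f scale0r addr0; exact: iX.
  - exists (f @^-1` X°) => //; apply: open_comp; last exact: open_interior.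
    by move=> t _; exact: cf.
  - exists (f @^-1` X); first by apply: closed_comp => // t _; exact: cf.
    apply/seteqP; split => t [t01 Xt]; split => //; first exact: (interior_subset Xt).
    by apply: iX => //; exact: fab.
move=> [_]; rewrite /= /f scale1r addrC subrK => Xy; exact: (interior_subset Xy).
Qed.

End cells.

(** * Grid cells and volume *)

Section grid_geometry.
Context (R : realType) (n M : nat) (p : 'I_n -> nat -> R).

Local Notation I := 'I_M.+2.
Local Notation K := {ffun 'I_n -> I}.
Implicit Types (k l : K) (i j : 'I_n) (x y : 'rV[R]_n) (X : set 'rV[R]_n) (A : pred K).

Hypothesis p0 : forall i, p i 0%N = 0.
Hypothesis p1 : forall i, p i M.+2 = 1.
Hypothesis p_le : forall i b, (b < M.+2)%N -> p i b <= p i b.+1.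

Lemma grid_mono i b c : (b <= c)%N -> (c <= M.+2)%N -> p i b <= p i c.
Proof.
elim: c => [|c IH]; first by rewrite leqn0 => /eqP ->.
rewrite leq_eqVlt => /orP[/eqP -> //|bc cM].
by apply: le_trans (p_le _ cM); apply: IH => //; exact: ltnW.
Qed.

Lemma grid_ge0 i b : (b <= M.+2)%N -> 0 <= p i b.
Proof. by move=> bM; rewrite -(p0 i) grid_mono. Qed.

Lemma grid_le1 i b : (b <= M.+2)%N -> p i b <= 1.
Proof. by move=> bM; rewrite -(p1 i) grid_mono. Qed.

Definition width i (a : I) : R := p i a.+1 - p i a.

Lemma width_ge0 i a : 0 <= width i a.
Proof. by rewrite subr_ge0 p_le. Qed.

Lemma width_weights : weights width.
Proof.
move=> i; split=> [a|]; first exact: width_ge0.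
rewrite /width -(big_mkord xpredT (fun a => p i a.+1 - p i a)).
by rewrite telescope_sumr// p0 p1 subr0.
Qed.

Definition cell k : set 'rV[R]_n := obox (fun j => p j (k j)) (fun j => p j (k j).+1).

Definition closed_cell k : set 'rV[R]_n := box (fun j => p j (k j)) (fun j => p j (k j).+1).

Lemma grid_locate i (t : R) : 0 <= t <= 1 -> exists a : I, p i a <= t <= p i a.+1.
Proof.
move=> /andP[t0 t1].
have [b [bM bt]] : exists b, (b < M.+2)%N /\ p i b <= t <= p i b.+1.
  suff H c : (c < M.+2)%N -> t <= p i c.+1 -> exists b, (b < M.+2)%N /\ p i b <= t <= p i b.+1.
    by apply: (H M.+1) => //; rewrite p1.
  elim: c => [|c IH] cM tc; first by exists 0%N; rewrite p0 t0 tc.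
  have [tp|pt] := leP t (p i c.+1); first by apply: IH => //; exact: ltnW.
  by exists c.+1; rewrite (ltW pt) tc.
by exists (Ordinal bM).
Qed.

Lemma grid_inj i (a b : I) (t : R) : p i a < t < p i a.+1 -> p i b < t < p i b.+1 -> a = b.
Proof.
move=> /andP[a1 a2] /andP[b1 b2]; apply/val_inj/eqP; rewrite eqn_leq /=.
apply/andP; split; rewrite leqNgt; apply/negP => ab.
  by have := grid_mono i ab (ltnW (ltn_ord a)); rewrite leNgt (lt_trans a1 b2).
by have := grid_mono i ab (ltnW (ltn_ord b)); rewrite leNgt (lt_trans b1 a2).
Qed.

Lemma cell_inj k l x : cell k x -> cell l x -> k = l.
Proof. by move=> kx lx; apply/ffunP => j; exact: grid_inj (kx j) (lx j). Qed.

Lemma unit_cube_locate x : unit_cube x -> exists k, closed_cell k x.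
Proof.
move=> x01; have /choice[f fP] : forall j, exists a : I, p j a <= x 0 j <= p j a.+1.
  by move=> j; exact: grid_locate.
by exists [ffun j => f j] => j; rewrite !ffunE.
Qed.

Lemma cell_sub_unit_cube k : cell k `<=` @unit_cube R n.
Proof.
move=> x kx j; have /andP[x1 x2] := kx j.
by rewrite (le_trans (grid_ge0 j _) (ltW x1)) ?(ltnW (ltn_ord _))// (le_trans (ltW x2))// grid_le1.
Qed.

(** Points on the grid hyperplanes are left free: these are null sets for the volume, and the
    density at a face is determined by the open cells beside it. *)
Definition cell_structure X A :=
  forall k x, cell k x -> X x <-> A k.

(** From above, X is covered by the closed cells of A and flat boxes of volume 0; from below, the
    open cells are disjoint. Widths may vanish, as they do for the special set. *)
Lemma Vol_cells X A : rV_measurable X -> X `<=` @unit_cube R n -> cell_structure X A ->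
  Vol X = (mass width A)%:E.
Proof.
move=> mX Xcube XA.
have wE k : (\prod_j width j (k j))%:E = Vol (cell k).
  by rewrite Vol_obox// => j; exact: p_le.
have wE' k : (\prod_j width j (k j))%:E = Vol (closed_cell k).
  by rewrite Vol_box// => j; exact: p_le.
have massE' : mass width A = \sum_(k : K | A k) \prod_j width j (k j).
  by rewrite [RHS]big_mkcond; apply: eq_bigr => k _; case: (A k); rewrite ?mulr1 ?mulr0.
apply/eqP; rewrite massE' -sumEFin eq_le; apply/andP; split.
  pose flat (ib : 'I_n * 'I_M.+3) : set 'rV[R]_n := box
    (fun j => if j == ib.1 then p j ib.2 else 0)
    (fun j => if j == ib.1 then p j ib.2 else 1).
  pose F (s : K + 'I_n * 'I_M.+3) := match s with
    | inl k => closed_cell k | inr ib => flat ib end.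
  pose P (s : K + 'I_n * 'I_M.+3) := match s with
    | inl k => A k | inr ib => true end.
  apply: le_trans (@Vol_cover _ _ _ P F X mX _ _) _.
  - by move=> [k|ib]; exact: rV_measurable_box.
  - move=> x Xx; have [k kx] := unit_cube_locate (Xcube x Xx).
    have [kx'|kx'] := pselect (cell k x).
      by exists (inl k) => //=; apply/(XA k x).
    have [j jx] : exists j, ~ p j (k j) < x 0 j < p j (k j).+1.
      by apply/existsNP.
    have /andP[x1 x2] := kx j.
    have [h|h] : x 0 j = p j (k j) \/ x 0 j = p j (k j).+1.
      move: x1 x2; rewrite !le_eqVlt => /orP[/eqP|x1]; first by left.
      by move=> /orP[/eqP|x2]; [right|case: jx; rewrite x1].
    + exists (inr (j, widen_ord (leqnSn _) (k j))) => // i /=.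
      by case: eqP => [->|_]; rewrite ?h ?lexx//; exact: Xcube.
    + exists (inr (j, lift ord0 (k j))) => // i /=.
      by case: eqP => [->|_]; rewrite ?h ?lexx//; exact: Xcube.
  rewrite big_sumType/= [X in (_ + X)%E]big1 ?adde0.
    by apply: lee_sum => k _; rewrite wE'.
  move=> [i b] _; rewrite Vol_box => [|j]; last by case: ifP.
  by rewrite (bigD1 i)//= eqxx subrr mul0r.
rewrite (eq_bigr _ (fun k _ => wE k)); apply: Vol_disjoint => //.
- by move=> k; exact: rV_measurable_obox.
- by move=> k Ak x kx; apply/(XA k).
- by move=> k l x; exact: cell_inj.
Qed.

End grid_geometry.

(** * Perimeter of a set with a given cell structure *)

Section perimeter_lower_bound.
Context (R : realType) (n M : nat) (p : 'I_n -> nat -> R) (n_gt0 : (0 < n)%N).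

Local Notation I := 'I_M.+2.
Local Notation K := {ffun 'I_n -> I}.
Implicit Types (k l : K) (i j : 'I_n) (x y : 'rV[R]_n).

Hypothesis p0 : forall i, p i 0%N = 0.
Hypothesis p1 : forall i, p i M.+2 = 1.
Hypothesis p_lt : forall i b, (b < M.+2)%N -> p i b < p i b.+1.

Let p_le i b : (b < M.+2)%N -> p i b <= p i b.+1.
Proof. by move=> bM; exact/ltW/p_lt. Qed.

Variables (X : set 'rV[R]_n) (A : pred K).
Hypothesis mX : rV_measurable X.
Hypothesis XA : cell_structure p X A.

Definition relative_boundary (Y : set 'rV[R]_n) : set 'rV[R]_n :=
  essential_boundary Y `\` boundary (@unit_cube R n).

Let inordb (b : 'I_M.+1) : (inord b : I) = b :> nat.
Proof. by rewrite inordK// ltnW// ltnS. Qed.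

Let inordbS (b : 'I_M.+1) : (inord b.+1 : I) = b.+1 :> nat.
Proof. by rewrite inordK// ltnS. Qed.

Lemma relative_boundary_face x k i (b : 'I_M.+1) : x 0 i = p i b.+1 ->
  (forall j, j != i -> p j (k j) < x 0 j < p j (k j).+1) ->
  A (upd k i (inord b)) != A (upd k i (inord b.+1)) ->
  relative_boundary X x.
Proof.
move=> xi xk Ak.
have bM : (b < M.+2)%N by rewrite ltnW// ltnS.
(* The two cells beside the face, glued along it. This open box lies in the cube, which keeps x off
   the boundary of the cube. *)
pose O := @obox R n (fun j => if j == i then p i b else p j (k j))
  (fun j => if j == i then p i b.+2 else p j (k j).+1).
have Ox : O x.
  move=> j; case: eqP => [->|/eqP/xk//].
  by rewrite xi !p_lt// ltnS.
have [e e0 eO] := (nbhs_rowP _ _).1 (obox_open Ox).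
split.
  apply: (essential_boundary_jump n_gt0 (i := i) (b := A (upd k i (inord b.+1))) mX e0).
  move=> y /eO Oy; rewrite neq_lt => /orP[yi|yi].
    rewrite ltNge (ltW yi)/=.
    have cy : cell p (upd k i (inord b)) y.
      move=> j; move: (Oy j); rewrite ffunE; case: eqP => // ->.
      by rewrite inordb -xi yi => /andP[-> _].
    rewrite (propext (XA cy)).
    by split; move: Ak; case: (A _) (A _) => [] [].
  have cy : cell p (upd k i (inord b.+1)) y.
    move=> j; move: (Oy j); rewrite ffunE; case: eqP => // ->.
    by rewrite inordbS -xi yi => /andP[_ ->].
  rewrite yi (propext (XA cy)).
  by split; move: Ak; case: (A _) (A _) => [] [].
case=> _; apply; apply: filterS (obox_open Ox) => y Oy j.
have := Oy j; case: eqP => [_|_] /andP[/ltW y1 /ltW y2]; apply/andP; split.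
- by apply: le_trans y1; apply: (grid_ge0 p0 p_le); exact: ltnW.
- by apply: le_trans y2 _; apply: (grid_le1 p1 p_le); exact: (ltn_ord b).
- by apply: le_trans y1; apply: (grid_ge0 p0 p_le); exact/ltnW/ltn_ord.
- by apply: le_trans y2 _; apply: (grid_le1 p1 p_le); exact: ltn_ord.
Qed.

(* The part of the boundary in the hyperplane x_i = p i b.+1 at distance at
   least e from the grid hyperplanes orthogonal to the other directions. *)
Let T (e : R) (ib : 'I_n * 'I_M.+1) : set 'rV[R]_n :=
  [set x | [/\ relative_boundary X x, x 0 ib.1 = p ib.1 ib.2.+1 &
    forall j (a : 'I_M.+3), j != ib.1 -> e <= `|x 0 j - p j a|]].

Let N := #|{: 'I_n * 'I_M.+3}|.

Let slab_massT i : slab_mass (width p) i (fun _ : K => true) = 1.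
Proof.
have ww := width_weights p0 p1 p_le.
rewrite -(@mass_layer R n M _ i ord0 (fun _ : K => true) ww) /mass.
under eq_bigr do rewrite mulr1.
by rewrite -(bigA_distr_bigA (width p)) big1// => j _; exact: (ww j).2.
Qed.

(** The rest of the unit face is covered by strips of width 2e around the other grid hyperplanes and
    by the cells on which the two layers agree. Each piece costs at most kappa times its area, and
    the areas of agreement and of difference add up to 1. *)
Let kappa_face_le (i0 : 'I_n) (e : R) (ib : 'I_n * 'I_M.+1) : 0 < e ->
  ((kappa R i0 * slab_dist (width p) ib.1 (layer ib.1 (inord ib.2) A)
      (layer ib.1 (inord ib.2.+1) A))%:E <=
   hausdorff_unnormalized n.-1%:R (T e ib) + (kappa R i0 * (2 * e) * N%:R)%:E)%E.
Proof.
case: ib => i b e0 /=.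
have k0 := kappa_ge0 R i0.
pose c j := if j == i then p i b.+1 else 0.
pose F (s : K + 'I_n * 'I_M.+3) : set 'rV[R]_n := match s with
  | inl k => box (fun j => if j == i then p i b.+1 else p j (k j))
                 (fun j => if j == i then p i b.+1 else p j (k j).+1)
  | inr ja => box (fun j => if j == i then p i b.+1 else if j == ja.1 then p j ja.2 - e else 0)
                  (fun j => if j == i then p i b.+1 else if j == ja.1 then p j ja.2 + e else 1) end.
pose P (s : K + 'I_n * 'I_M.+3) := match s with
  | inl k => (k i == ord0) && ~~ (layer i (inord b) A k (+) layer i (inord b.+1) A k)
  | inr ja => ja.1 != i end.
have : ((kappa R i0)%:E <= hausdorff_unnormalized n.-1%:R (T e (i, b)) +
    \sum_(s | P s) hausdorff_unnormalized n.-1%:R (F s))%E.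
  rewrite (@kappa_face R n i0 i c).
  apply: (@le_trans _ _ (hausdorff_unnormalized n.-1%:R
      (T e (i, b) `|` [set x | face_cube i c 1 x /\ ~ T e (i, b) x]))).
    by apply: le_hausdorff => x Qx; have [|] := pselect (T e (i, b) x); [left|right].
  apply: le_trans (hausdorffU _ _ _) _; apply: leeD => //.
  apply: hausdorff_cover => x [Qx Tx].
  have xi : x 0 i = p i b.+1.
    by move: (Qx i); rewrite /c eqxx mul0r addr0 => /le_anti.
  have xj j : j != i -> 0 <= x 0 j <= 1.
    by move=> ji; move: (Qx j); rewrite /c (negbTE ji) mul1r add0r.
  have [[[j a] /= [ji xa]]|far] := pselect (exists ja : 'I_n * 'I_M.+3,
      ja.1 != i /\ `|x 0 ja.1 - p ja.1 ja.2| < e).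
    exists (inr (j, a)) => // l /=.
    have [->|li] := eqVneq l i; first by rewrite xi lexx.
    have [->|lj] := eqVneq l j; last exact: xj.
    by move: xa; rewrite ltr_norml => /andP[? ?]; apply/andP; split; lra.
  have {}far j (a : 'I_M.+3) : j != i -> e <= `|x 0 j - p j a|.
    by move=> ji; rewrite leNgt; apply/negP => xa; apply: far; exists (j, a).
  have [k0' k0x] : exists k, forall j, j != i -> p j (k j) < x 0 j < p j (k j).+1.
    have /choice[f fP] : forall j, exists a : I, j != i -> p j a < x 0 j < p j a.+1.
      move=> j; have [->|ji] := eqVneq j i; first by exists ord0.
      have [a /andP[h1 h2]] := grid_locate p0 p1 j (xj j ji); exists a => _.
      have := far j (widen_ord (leqnSn _) a) ji; have := far j (lift ord0 a) ji => /=.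
      rewrite /bump /= add1n => f1 f2.
      rewrite !lt_neqAle h1 h2 !andbT; apply/andP; split; apply/eqP => h.
        by move: f2; rewrite h subrr normr0; lra.
      by move: f1; rewrite h subrr normr0; lra.
    by exists [ffun j => f j] => j ji; rewrite ffunE; exact: fP.
  pose k := upd k0' i ord0.
  have kx j : j != i -> p j (k j) < x 0 j < p j (k j).+1.
    by move=> ji; rewrite upd_neq//; exact: k0x.
  exists (inl k).
    rewrite /= updii eqxx/=; apply/negP => Ak; apply: Tx; split => //.
    apply: (relative_boundary_face xi kx).
    by move: Ak; rewrite /layer; case: (A _) (A _) => [] [].
  move=> j /=; case: (eqVneq j i) => [->|ji]; first by rewrite xi lexx.
  by have /andP[/ltW -> /ltW ->] := kx j ji.
have -> : (kappa R i0)%:E = (kappa R i0 * slab_dist (width p) i (layer i (inord b) A)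
      (layer i (inord b.+1) A))%:E + (kappa R i0 * slab_mass (width p) i
      (fun k => ~~ (layer i (inord b) A k (+) layer i (inord b.+1) A k)))%:E :> \bar R.
  rewrite -EFinD -mulrDr.
  have -> : slab_dist (width p) i (layer i (inord b) A) (layer i (inord b.+1) A) +
      slab_mass (width p) i (fun k => ~~ (layer i (inord b) A k (+) layer i (inord b.+1) A k)) =
      slab_mass (width p) i (fun _ : K => true) + slab_mass (width p) i (fun _ : K => false).
    by apply: slab_massD => k; case: (_ (+) _).
  rewrite slab_massT [slab_mass _ _ _]big1 ?addr0 ?mulr1// => k _.
  by rewrite mulr0.
move=> H; rewrite -(@leeD2rE _ (kappa R i0 * slab_mass (width p) i
      (fun k => ~~ (layer i (inord b) A k (+) layer i (inord b.+1) A k)))%:E)//.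
apply: le_trans H _; rewrite -addeA; apply: leeD => //.
rewrite big_sumType/= addeC; apply: leeD.
  apply: (@le_trans _ _ (\sum_(ja : 'I_n * 'I_M.+3 | ja.1 != i) (kappa R i0 * (2 * e))%:E)%E).
    apply: lee_sum => -[j a] /= ji.
    apply: le_trans (@hausdorff_box_le R n i0 i _ _ _ _) _; first by rewrite eqxx.
      by move=> l; case: ifP => // _; case: ifP => // _; lra.
    rewrite lee_fin ler_wpM2l// (bigD1 j)//= (negbTE ji) eqxx big1 ?mulr1; first by lra.
    by move=> l /andP[/negbTE -> /negbTE ->]; rewrite subr0.
  rewrite sumEFin lee_fin sumr_const -[leLHS]mulr_natr ler_wpM2l ?ler_nat ?max_card//.
  by rewrite !mulr_ge0// ltW.
apply: (@le_trans _ _ (\sum_(k : K | (k i == ord0) &&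
    ~~ (layer i (inord b) A k (+) layer i (inord b.+1) A k))
    (kappa R i0 * \prod_(j | j != i) width p j (k j))%:E)%E).
  apply: lee_sum => k _.
  apply: le_trans (@hausdorff_box_le R n i0 i _ _ _ _) _; first by rewrite eqxx.
    by move=> l; case: ifP => // _; exact: p_le.
  rewrite lee_fin ler_wpM2l//; apply: ler_prod => j /negbTE ->.
  by rewrite lexx andbT; exact: width_ge0.
rewrite sumEFin lee_fin -mulr_sumr ler_wpM2l// big_mkcondr/=.
by apply: ler_sum => k _; case: ifP => _; rewrite ?mulr1 ?mulr0.
Qed.

(* The sets T e ib are pairwise at distance at least min(e, g), where g is the
   smallest width, so that their Hausdorff measures add up. *)
Lemma relper_le_hausdorff i0 :
  ((kappa R i0 * relper (width p) A)%:E <=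
   hausdorff_unnormalized n.-1%:R (relative_boundary X))%E.
Proof.
have [g g0 gP] : exists2 g, 0 < g & forall i b, (b < M.+2)%N -> g <= p i b.+1 - p i b.
  exists (\big[Order.min/1]_(ib : 'I_n * I) (p ib.1 ib.2.+1 - p ib.1 ib.2)).
    by apply: lt_bigmin => // -[i b] _; rewrite subr_gt0 p_lt.
  by move=> i b bM; apply: (@bigmin_le _ _ _ _ (i, Ordinal bM)).
pose C := kappa R i0 * 2 * N%:R * #|{: 'I_n * 'I_M.+1}|%:R.
have C0 : 0 <= C by rewrite !mulr_ge0 ?kappa_ge0.
suff H e : 0 < e -> ((kappa R i0 * relper (width p) A)%:E <=
    hausdorff_unnormalized n.-1%:R (relative_boundary X) + (C * e)%:E)%E.
  apply/lee_addgt0Pr => e e0.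
  have C1 : 0 < C + 1 by lra.
  apply: le_trans (H (e / (C + 1)) _) _; first by rewrite divr_gt0.
  apply: leeD => //; rewrite lee_fin mulrCA -[leRHS]mulr1.
  by rewrite ler_wpM2l ?(ltW e0)// ler_pdivrMr// mul1r lerDl.
move=> e0; have ww := width_weights p0 p1 p_le.
apply: (@le_trans _ _ (\sum_(ib : 'I_n * 'I_M.+1)
    (hausdorff_unnormalized n.-1%:R (T e ib) + (kappa R i0 * (2 * e) * N%:R)%:E))%E).
  rewrite (_ : relper _ _ = \sum_(ib : 'I_n * 'I_M.+1) slab_dist (width p) ib.1
      (layer ib.1 (inord ib.2) A) (layer ib.1 (inord ib.2.+1) A)).
    by rewrite mulr_sumr -sumEFin; apply: lee_sum => ib _; exact: kappa_face_le.
  rewrite -(pair_big xpredT xpredT (fun i (b : 'I_M.+1) => slab_dist (width p) i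
      (layer i (inord b) A) (layer i (inord b.+1) A)))/=.
  by apply: eq_bigr => i _; rewrite areaE.
rewrite big_split/=; apply: leeD; last first.
  by rewrite sumEFin lee_fin sumr_const -mulr_natr /C le_eqVlt; apply/orP; left; apply/eqP; ring.
pose d := Order.min e g.
have d0 : 0 < d by rewrite lt_min e0.
apply: le_trans (hausdorff_separated _ d0 (index_enum_uniq _) _) _.
  move=> [i b] [i' b'] x y ibn [_ /= xi xj] [_ /= yi yj].
  apply: le_trans (enorm_ge (x - y) i); rewrite !mxE.
  (* For different directions, x lies on a grid hyperplane from which y keeps distance e; for equal
     directions, two parallel grid hyperplanes are at least g apart. *)
  have [ii'|ii'] := eqVneq i i'; last first.
    have bM : (b.+1 < M.+3)%N by rewrite ltnS ltnW// ltnS.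
    have := yj i (Ordinal bM) ii'; rewrite /= -xi distrC.
    by apply: le_trans; rewrite ge_min lexx.
  subst i'; have bb : b != b' by apply: contraNneq ibn => ->.
  rewrite xi yi.
  wlog bb' : b b' {ibn xi xj yi yj} bb / (b < b')%N.
    move=> Hw; case: (ltngtP b b') => [|bb'|/val_inj bb']; first exact: Hw.
      by rewrite distrC; apply: Hw => //; rewrite eq_sym.
    by rewrite bb' eqxx in bb.
  rewrite distrC ger0_norm; last first.
    rewrite subr_ge0; apply: (grid_mono p_le); first exact: (ltnW bb').
    exact: ltnW (ltn_ord b').
  apply: (@le_trans _ _ g); first by rewrite ge_min lexx orbT.
  apply: le_trans (gP i b' _) _; first exact: ltnW (ltn_ord b').
  rewrite lerD2l lerN2; apply: (grid_mono p_le) => //.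
  exact: leqW (ltnW (ltn_ord b')).
apply: le_hausdorff => x; rewrite -(bigcup_seq _ (T e)) => -[ib _ [rx _ _]]; exact: rx.
Qed.

End perimeter_lower_bound.

(** * The special set *)

Section special_set.
Context (R : realType) (n M : nat) (n_gt0 : (0 < n)%N).

Local Notation I := 'I_M.+2.
Local Notation K := {ffun 'I_n -> I}.
Local Notation one := (inord 1 : I).
Implicit Types (k : K) (i j : 'I_n) (x y : 'rV[R]_n).

Variables (w : 'I_n -> I -> R) (A : pred K).
Hypothesis ww : weights w.
Hypothesis cA : forall i, compressed w A i.
Hypothesis A_neq0 : exists k, A k.

Let s i : R := w i ord0.

Let s01 i : 0 < s i < 1.
Proof. by have [_ w0 w1 e] := cA i; rewrite -e w0 ltrDl. Qed.

(** All breakpoints from index 2 on are 1, which makes the slabs from 2 on degenerate. *)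
Let p i (b : nat) : R := match b with 0%N => 0 | 1%N => s i | _ => 1 end.

Let p_le i b : (b < M.+2)%N -> p i b <= p i b.+1.
Proof. by have /andP[/ltW ? /ltW ?] := s01 i; case: b => [|[|b]]. Qed.

Let val_one : one = 1%N :> nat. Proof. by rewrite inordK. Qed.

Let neq_one (a : I) : a != ord0 -> a != one -> exists b, (a : nat) = b.+2.
Proof.
by rewrite -!val_eqE/= val_one; case: (nat_of_ord a) => [|[|b]]// _ _; exists b.
Qed.

Let width_p : width p = w.
Proof.
apply/funext => i; apply/funext => a.
have [_ w0 w1 e] := cA i.
have [->|a0] := eqVneq a ord0; first by rewrite /width /p subr0.
have [->|a1] := eqVneq a one.
  by rewrite /width val_one /p -e addrC addKr.
have [b ab] := neq_one a0 a1.
rewrite /width ab /p subrr.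
have [wge0] := ww i.
rewrite (bigD1 ord0)//= (bigD1 one) ?one_neq0//= addrA e -[RHS]addr0 => /addrI /eqP.
rewrite psumr_eq0 => [/allP /(_ a)|b' _]; last exact: wge0.
by rewrite mem_index_enum a0 a1 => /(_ isT) /eqP.
Qed.

(** Change one coordinate at a time: moving between nonzero indices is free, and lowering an index
    to 0 is nestedness. *)
Lemma two_layered_down k (l : K) : (forall i, two_layered i A) ->
  A k -> (forall j, k j = ord0 -> l j = ord0) -> A l.
Proof.
move=> tA Ak kl.
have step k' i a : A k' -> (k' i = ord0 -> a = ord0) -> A (upd k' i a).
  move=> Ak' k'a; have [t1 t2] := tA i.
  have [ki|ki] := eqVneq (k' i) ord0; first by rewrite (k'a ki) -ki updid.
  have Ak1 : A (upd k' i one) by rewrite -(t1 _ (k' i))// updid.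
  have [->|a0] := eqVneq a ord0; first exact: t2.
  by rewrite t1.
suff H (r : seq 'I_n) : A [ffun j => if j \in r then l j else k j].
  have := H (enum 'I_n); congr (A _).
  by apply/ffunP => j; rewrite ffunE mem_enum.
elim: r => [|i r IH].
  by rewrite (_ : finfun _ = k)//; apply/ffunP => j; rewrite ffunE.
rewrite (_ : finfun _ = upd [ffun j => if j \in r then l j else k j] i (l i)).
  by apply: step => //; rewrite ffunE; case: ifP => // _; exact: kl.
by apply/ffunP => j; rewrite !ffunE inE; case: eqP => [->|].
Qed.

Let down k (l : K) : A k -> (forall j, k j = ord0 -> l j = ord0) -> A l.
Proof. by apply: two_layered_down => i; case: (cA i). Qed.

(** The cut itself goes to the lower, larger slab, so that the resulting set is closed. *)
Let bit i (t : R) : I := if t <= s i then ord0 else one.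

Definition cell_code x : K := [ffun j => bit j (x 0 j)].

Definition special_set : set 'rV[R]_n := [set x | unit_cube x /\ A (cell_code x)].

Local Notation Xs := special_set.

Let cell_codeE k x : cell p k x -> cell_code x = k.
Proof.
move=> kx; apply/ffunP => j; rewrite ffunE /bit; move: (kx j).
have [->|k0] := eqVneq (k j) ord0; first by move=> /andP[_ /ltW] /= ->.
have [->|k1] := eqVneq (k j) one.
  by rewrite val_one /= => /andP[xs _]; rewrite leNgt xs.
by have [b ->] := neq_one k0 k1; rewrite /= => /andP[/lt_trans] /[apply]; rewrite ltxx.
Qed.

Lemma special_set_cells : cell_structure p Xs A.
Proof.
move=> k x kx; have kE := cell_codeE kx; split=> [[_]|Ak]; first by rewrite kE.
split; last by rewrite kE.
exact: cell_sub_unit_cube kx.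
Qed.

Let code_box k x : A k -> unit_cube x ->
  (forall j, x 0 j <= p j (k j).+1) -> Xs x.
Proof.
move=> Ak x01 xk; split => //; apply: (down Ak) => j kj; rewrite ffunE /bit.
by have := xk j; rewrite kj /= => ->.
Qed.

Let bit_le i (t : R) : t <= 1 -> t <= p i (bit i t).+1.
Proof. by move=> t1; rewrite /bit; case: ifP => //; rewrite val_one. Qed.

Lemma special_set_closed : closed Xs.
Proof.
rewrite (_ : Xs = \big[setU/set0]_(k | A k) @box R n (fun=> 0) (fun j => p j (k j).+1)).
  rewrite big_mkcond/=; apply: closed_bigsetU => k _; case: ifP => _; last exact: closed0.
  exact: box_closed.
apply/seteqP; split => [x [x01 Ax]|x].
  rewrite -bigcup_seq_cond; exists (cell_code x); first by rewrite /= mem_index_enum.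
  by move=> j; have /andP[x0 x1] := x01 j; rewrite x0/= ffunE bit_le.
rewrite -bigcup_seq_cond => -[k /andP[_ Ak] xk]; apply: (code_box Ak) => j.
  have /andP[-> xj] := xk j; apply: le_trans xj _ => /=.
  by have /andP[_ /ltW] := s01 j; case: (nat_of_ord _).
by case/andP: (xk j).
Qed.

Lemma special_set_compact : compact Xs.
Proof.
have cI : compact [set v : 'rV[R]_n | forall i, `[0, 1]%classic (v ord0 i)].
  apply: (@rV_compact R n (fun=> `[0, 1]%classic)) => i; exact: segment_compact.
apply: subclosed_compact special_set_closed cI _.
by move=> x [x01 _] i /=; rewrite in_itv/=; exact: x01.
Qed.

Let special_set_measurable : rV_measurable Xs.
Proof. by apply: rV_measurable_closed; [exact: special_set_closed|move=> x []]. Qed.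

Lemma Vol_special_set : Vol Xs = (mass w A)%:E.
Proof.
rewrite -width_p; apply: Vol_cells => //; last exact: special_set_cells.
by move=> x [].
Qed.

Lemma boundary_special_set x : boundary Xs x ->
  Xs x /\ exists j, x 0 j \in [:: 0; s j; 1].
Proof.
move=> [clx ix]; have Xx : Xs x by move/closure_id : special_set_closed => ->.
split => //; apply: contrapT => xj.
have xc : cell p (cell_code x) x.
  move=> j; have : x 0 j \notin [:: 0; s j; 1] by apply/negP => h; apply: xj; exists j.
  rewrite !inE !negb_or => /and3P[h0 hs h1].
  have [/(_ j)/andP[x0 x1] _] := Xx.
  rewrite ffunE /bit; case: (leP (x 0 j) (s j)) => xs.
    by rewrite /= lt_neqAle eq_sym h0 x0/= lt_neqAle hs.
  by rewrite val_one /= xs lt_neqAle h1.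
apply: ix; apply: filterS (obox_open xc) => y yc.
by apply/(special_set_cells yc); have [_] := Xx.
Qed.

Lemma special_set_cubical : cubical Xs.
Proof.
split; [exact: special_set_compact|by move=> x []|].
exists [seq (j, c) | j <- enum 'I_n, c <- [:: 0; s j; 1]] => x.
move=> /boundary_special_set[_ [j xj]]; exists (j, x 0 j); last by [].
by apply/allpairsPdep; exists j, (x 0 j); rewrite mem_enum.
Qed.

(** Along the line only the i-th entry of the code varies, so the intersection is [0,1], [0, s i] or
    empty, hence already the initial segment of its own length. *)
Let line_special i y : unit_cube y -> y 0 i = 0 ->
  steiner_segment Xs i y = [set t | Xs (y + t *: basis_vec R i)].
Proof.
move=> y01 yi; have /andP[s0 s1] := s01 i.
have coord t j : (y + t *: basis_vec R i) 0 j = if j == i then t else y 0 j.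
  rewrite !mxE eqxx/=; case: eqP => [->|_]; first by rewrite yi add0r mulr1.
  by rewrite mulr0 addr0.
have codeE t : cell_code (y + t *: basis_vec R i) = upd (cell_code y) i (bit i t).
  by apply/ffunP => j; rewrite !ffunE coord; case: eqP => [->|].
have cubeE t : unit_cube (y + t *: basis_vec R i) <-> 0 <= t <= 1.
  split=> [/(_ i)|t01 j]; rewrite coord ?eqxx//.
  by case: eqP.
have lineE : [set t | Xs (y + t *: basis_vec R i)] =
    if A (upd (cell_code y) i one) then `[0, 1]%classic
    else if A (upd (cell_code y) i ord0) then `[0, s i]%classic else set0.
  have [[_ t2] _ _ _] := cA i.
  case: ifPn => [A1|A1].
    apply/seteqP; split => t /=; rewrite in_itv/=; first by move=> [/cubeE].
    move=> t01; split; first exact/cubeE.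
    by rewrite codeE /bit; case: ifP => // _; exact: t2.
  case: ifPn => [A0|A0]; apply/seteqP; split => t //=.
  - move=> [/cubeE/andP[t0 _]]; rewrite codeE /bit in_itv/= t0.
    by case: ifP => //; rewrite (negbTE A1).
  - rewrite in_itv/= => /andP[t0 ts]; split.
      by apply/cubeE; rewrite t0 (le_trans ts (ltW s1)).
    by rewrite codeE /bit ts.
  - by move=> [_]; rewrite codeE /bit; case: ifP; rewrite ?(negbTE A0) ?(negbTE A1).
have lenE : line_length Xs i y = if A (upd (cell_code y) i one) then 1%E
    else if A (upd (cell_code y) i ord0) then (s i)%:E else 0%E.
  rewrite /line_length lineE; case: ifP => _.
    by rewrite lebesgue_measure_itv/= lte_fin ltr01 oppr0 adde0.
  case: ifP => _; last by rewrite measure0.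
  by rewrite lebesgue_measure_itv/= lte_fin s0 oppr0 adde0.
rewrite lineE /steiner_segment lenE; apply/seteqP; split => t /=.
  case: ifP => _; first by move=> [_ t0 t1]; rewrite /= in_itv/= t0 -lee_fin.
  case: ifP => _; first by move=> [_ t0 t1]; rewrite /= in_itv/= t0 -lee_fin.
  by case; rewrite eqxx.
case: ifP => _; first by rewrite /= in_itv/= => /andP[t0 t1]; split => //; rewrite eqe oner_eq0.
case: ifP => _ //; rewrite /= in_itv/= => /andP[t0 t1]; split => //.
by rewrite eqe gt_eqF.
Qed.

Lemma special_set_symmetrized : symmetrized Xs.
Proof.
move=> i; apply/seteqP; split => [x [y [yi y01] [t tseg <-]]|x Xx].
  by move: tseg; rewrite line_special.
have [x01 _] := Xx.
pose y := x - x 0 i *: basis_vec R i.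
have coord j : y 0 j = if j == i then 0 else x 0 j.
  rewrite !mxE eqxx/=; case: eqP => [->|_]; first by rewrite mulr1 subrr.
  by rewrite mulr0 subr0.
have yi : y 0 i = 0 by rewrite coord eqxx.
have y01 : unit_cube y by move=> j; rewrite coord; case: eqP => _; rewrite ?lexx ?ler01.
exists y => //; exists (x 0 i); last by rewrite /y subrK.
by rewrite line_special//= /y subrK.
Qed.

Lemma special_set_corner : exists2 r : R, 0 < r &
  open_cube0 r `&` Xs = open_cube0 r `&` @unit_cube R n.
Proof.
exists (\big[Order.min/1]_j s j).
  by apply: lt_bigmin => // j _; case/andP: (s01 j).
apply/seteqP; split => x [xr]; first by move=> [x01 _].
move=> x01; split => //; split => //.
have [k Ak] := A_neq0; apply: (down Ak) => j _; rewrite ffunE /bit.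
rewrite (le_trans (ler_norm _))// ltW// (lt_le_trans (xr j))//.
exact: bigmin_le.
Qed.

(** If t is not the cut, a boundary point with x_i = t lies on a second hyperplane, orthogonal to
    some e_j with j != i. So the slice sits in finitely many flats of dimension n - 2. For n = 1
    there is no such j, the slice is empty and its dimension is -oo. *)
Lemma special_set_singular i (t : R) : 0 < t < 1 -> singular Xs i t -> t = s i.
Proof.
move=> /andP[t0 t1]; apply: contraPP => ts sing.
pose F (jc : 'I_n * 'I_3) := cube_flat [set i; jc.1]
  (fun l => if l == i then t else [:: 0; s jc.1; 1]`_jc.2).
have sliceF x : slice Xs i t x -> exists2 jc, jc.1 != i & F jc x.
  move=> [bx xi]; have [[x01 _] [j]] := boundary_special_set bx.
  have [->|ji xj] := eqVneq j i.
    by rewrite xi !inE (gt_eqF t0) (lt_eqF t1) orbF/= => /eqP.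
  have idx : (index (x 0 j)%R [:: 0; s j; 1]%R < 3)%N by rewrite index_mem.
  exists (j, Ordinal idx) => //; split => // l.
  rewrite !inE => /orP[/eqP ->|/eqP ->]; first by rewrite eqxx.
  by rewrite (negbTE ji) /= nth_index.
have H0 d : n%:R - 2 < d -> hausdorff_unnormalized d (slice Xs i t) = 0%E.
  move=> nd; apply/eqP; rewrite eq_le hausdorff_ge0 andbT.
  apply: le_trans (hausdorff_cover d sliceF) _.
  rewrite big1// => -[j c] /= ji; apply: hausdorff_flat_eq0.
  apply: le_lt_trans nd; rewrite lerBrDr -natrD ler_nat.
  have h := cardsC [set i; j]; rewrite cards2 eq_sym ji card_ord in h.
  by rewrite /= addnC h.
have : (hausdorff_dim (slice Xs i t) <= (n%:R - 2)%:E)%E.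
  apply: ge_ereal_sup => _ [d [d0 Hd] <-]; rewrite lee_fin leNgt; apply/negP => nd.
  by rewrite H0// ltxx in Hd.
rewrite sing lee_fin; apply/negP; rewrite -ltNge.
by rewrite ltrBlDr -{1}(prednK n_gt0) -natr1; lra.
Qed.

Lemma special_special_set : (0 < mass w A <= 2^-1) -> special Xs.
Proof.
move=> /andP[V0 V1]; split.
- split; first exact: special_set_cubical.
  by rewrite Vol_special_set !lte_fin lee_fin V0.
- exact: special_set_symmetrized.
- exact: special_set_corner.
- by move=> i t u t01 u01 /special_set_singular -> // /special_set_singular ->.
Qed.

(** Relative boundary points lie on cuts. Those on two cuts form a null set; the others lie on faces
    whose two neighbouring cells differ. *)
Lemma hausdorff_special_set i0 :
  (hausdorff_unnormalized n.-1%:R (relative_boundary Xs) <=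
   (kappa R i0 * relper w A)%:E)%E.
Proof.
have k0 := kappa_ge0 R i0.
pose F (u : ('I_n * K) + ('I_n * 'I_n)) : set 'rV[R]_n := match u with
  | inl ik => box (fun j => if j == ik.1 then s ik.1 else p j (ik.2 j))
                  (fun j => if j == ik.1 then s ik.1 else p j (ik.2 j).+1)
  | inr ij => box (fun l => if (l == ij.1) || (l == ij.2) then s l else 0)
                  (fun l => if (l == ij.1) || (l == ij.2) then s l else 1) end.
pose P (u : ('I_n * K) + ('I_n * 'I_n)) := match u with
  | inl ik => (ik.2 ik.1 == ord0) &&
      (layer ik.1 ord0 A ik.2 (+) layer ik.1 one A ik.2)
  | inr ij => ij.2 != ij.1 end.
apply: le_trans (@hausdorff_cover R n _ P F _ _ _) _.
  move=> x [/(essential_boundary_sub n_gt0) bx ncube].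
  have [Xx [i xi]] := boundary_special_set bx.
  have [x01 Ax] := Xx.
  have [e e0 eC] : exists2 e : R, 0 < e & forall y, (forall i, `|x 0 i - y 0 i| < e) -> unit_cube y.
    apply/nbhs_rowP; apply: contrapT => ix; apply: ncube; split => //.
    exact: subset_closure.
  have x_gt0 j : 0 < x 0 j < 1.
    have far (z : R) : `|z| < e -> 0 <= x 0 j + z <= 1.
      move=> ze; have := eC (\row_l (x 0 l + z)) _ j; rewrite mxE; apply => l.
      by rewrite mxE opprD addrA subrr sub0r normrN.
    have := far (e / 2); have := far (- (e / 2)).
    rewrite normrN gtr0_norm ?divr_gt0// => /(_ _)/andP[|h1 _]; first by lra.
    move=> /(_ _)/andP[|_ h2]; first by lra.
    by apply/andP; split; lra.
  have {}xi : x 0 i = s i.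
    move: xi; have /andP[h0 h1] := x_gt0 i.
    by rewrite !inE (gt_eqF h0) (lt_eqF h1) orbF/= => /eqP.
  have [[j ji xj]|xj] := pselect (exists2 j, j != i & x 0 j = s j).
    exists (inr (i, j)) => // l /=.
    case: ifP => [/orP[/eqP ->|/eqP ->]|_]; [by rewrite xi lexx|by rewrite xj lexx|exact: x01].
  pose k := upd (cell_code x) i ord0.
  have kx j : j != i -> p j (k j) < x 0 j < p j (k j).+1.
    move=> ji; rewrite upd_neq// ffunE /bit.
    have xs : x 0 j != s j by apply/eqP => h; apply: xj; exists j.
    have /andP[h0 h1] := x_gt0 j.
    case: (leP (x 0 j) (s j)) => h; first by rewrite /= h0/= lt_neqAle xs.
    by rewrite val_one /= h.
  exists (inl (i, k)).
    rewrite /= updii eqxx/= /layer /k !upd_upd.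
    have ki : cell_code x i = ord0 by rewrite ffunE /bit xi lexx.
    have -> : A (upd (cell_code x) i ord0) by rewrite -ki updid.
    (* Were the cell above the cut kept as well, a whole neighbourhood of x would lie in the set. *)
    apply/negP => A1; case: bx => _; apply.
    pose O := @obox R n (fun j => if j == i then 0 else p j (k j))
      (fun j => if j == i then 1 else p j (k j).+1).
    have Ox : O x by move=> j; case: eqP => [->//|/eqP/kx].
    apply: filterS (obox_open Ox) => y Oy.
    apply: (code_box A1).
      move=> j; have := Oy j; case: eqP => [_|_] /andP[/ltW h0 /ltW h1]; first by rewrite h0.
      apply/andP; split; first by apply: le_trans h0; rewrite (@grid_ge0 R n M)// ltnW.
      by apply: le_trans h1 _; rewrite (@grid_le1 R n M).
    move=> j; have [->|ji] := eqVneq j i.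
      by rewrite updii val_one /=; have := Oy i; rewrite eqxx => /andP[_ /ltW].
    have := Oy j; rewrite (negbTE ji) => /andP[_ /ltW].
    by rewrite /k !upd_neq.
  move=> j /=; case: (eqVneq j i) => [->|ji]; first by rewrite xi lexx.
  by have /andP[/ltW -> /ltW ->] := kx j ji.
rewrite big_sumType/= [X in (_ + X)%E]big1 ?adde0; last first.
  move=> [i j] /= ji; apply/eqP; rewrite eq_le hausdorff_ge0 andbT.
  apply: le_trans (@hausdorff_box_le R n i0 i _ _ _ _) _; first by rewrite eqxx.
    by move=> l; case: ifP.
  by rewrite (bigD1 j)//= eqxx orbT subrr mul0r mulr0.
apply: (@le_trans _ _ (\sum_(ik : 'I_n * K | (ik.2 ik.1 == ord0) &&
    (layer ik.1 ord0 A ik.2 (+) layer ik.1 one A ik.2))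
    (kappa R i0 * \prod_(j | j != ik.1) w j (ik.2 j))%:E)%E).
  apply: lee_sum => -[i k] _ /=.
  apply: le_trans (@hausdorff_box_le R n i0 i _ _ _ _) _; first by rewrite eqxx.
    by move=> l; case: ifP => // _; exact: p_le.
  rewrite lee_fin ler_wpM2l//; apply: ler_prod => j /negbTE ->.
  by rewrite -width_p lexx andbT; exact: width_ge0.
rewrite sumEFin lee_fin -mulr_sumr ler_wpM2l//.
rewrite -(pair_big_dep xpredT (fun i k => (k i == ord0) &&
    (layer i ord0 A k (+) layer i one A k)) (fun i k => \prod_(j | j != i) w j (k j)))/=.
apply: ler_sum => i _.
apply: le_trans (slab_dist_area i A ord0 one ww).
rewrite big_mkcondr/=; apply: ler_sum => k _.
by case: ifP => _; rewrite ?mulr1 ?mulr0.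
Qed.

End special_set.

(** * Choice of the grid and conclusion *)

(** One list serves all directions. Adding 1/2 ensures at least two slabs, so that the indices 0 and
    1 always exist. *)
Lemma breakpoints (R : realType) (cs : seq R) : exists (M : nat) (q : nat -> R),
  [/\ q 0%N = 0, q M.+2 = 1, (forall b c, (b < c)%N -> (c <= M.+2)%N -> q b < q c) &
    forall c, c \in cs -> 0 <= c <= 1 -> exists2 b, (b <= M.+2)%N & c = q b].
Proof.
pose l := [:: 0, 1, 2^-1 & [seq c <- cs | 0 <= c <= 1]].
pose bs := sort <=%R (undup l).
have bsl : bs =i l by move=> c; rewrite mem_sort mem_undup.
have bs_sorted : sorted <%R bs by rewrite lt_sorted_uniq_le sort_uniq undup_uniq sort_le_sorted.
have bs01 c : c \in bs -> 0 <= c <= 1.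
  rewrite bsl !inE mem_filter => /or4P[/eqP ->|/eqP ->|/eqP ->|/andP[//]]; rewrite ?lexx ?ler01//.
  by apply/andP; split; lra.
have sbs : (3 <= size bs)%N.
  rewrite (@uniq_leq_size _ [:: 0; 1; 2^-1])//.
    rewrite /= !inE !negb_or eq_sym oner_eq0 eq_sym invr_eq0 pnatr_eq0/= andbT.
    by rewrite eq_sym invr_eq1 (eqr_nat _ 2 1).
  by move=> c; rewrite bsl !inE => /or3P[]->; rewrite ?orbT.
have [M sM] : exists M, size bs = M.+3.
  by exists (size bs - 3)%N; rewrite -addn3 subnK.
pose q b := nth 1 bs b.
have q_lt b c : (b < c)%N -> (c <= M.+2)%N -> q b < q c.
  move=> bc cM; rewrite /q (lt_sorted_ltn_nth 1 bs_sorted) ?inE ?sM//.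
  exact: ltn_trans bc _.
have qP c : c \in bs -> exists2 b, (b <= M.+2)%N & c = q b.
  by move=> cbs; exists (index c bs); rewrite ?/q ?nth_index// -ltnS -sM index_mem.
have q01 b : (b <= M.+2)%N -> 0 <= q b <= 1.
  by move=> bM; apply: bs01; rewrite mem_nth// sM.
exists M, q; split => //.
- have [|b bM qb] := qP 0; first by rewrite bsl inE eqxx.
  case: (posnP b) qb => [-> //|b0 qb].
  have /andP[q0 _] := q01 0%N isT.
  by have := q_lt _ _ b0 bM; rewrite -qb ltNge q0.
- have [|b bM qb] := qP 1; first by rewrite bsl !inE eqxx orbT.
  move: bM qb; rewrite leq_eqVlt => /orP[/eqP -> //|bM qb].
  have /andP[_ q1] := q01 _ (leqnn M.+2).
  by have := q_lt _ _ bM (leqnn _); rewrite -qb ltNge q1.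
- move=> c ccs c01; apply: qP; rewrite bsl !inE mem_filter c01 ccs !orbT//.
Qed.

Theorem proposition1p8 (R : realType) (n : nat) (n_gt0 : (0 < n)%N)
    (X : set 'rV[R]_n) (X_cubical : cubical X)
    (VX : (0 < Vol X <= (2^-1)%:E)%E) :
  exists Xs : set 'rV[R]_n,
    special Xs /\ Vol Xs = Vol X /\ (RelPer Xs <= RelPer X)%E.
Proof.
have [Xcompact Xcube [hs Xhs]] := X_cubical.
have Xclosed : closed X by apply: compact_closed => //; exact: norm_hausdorff.
have mX := rV_measurable_closed Xclosed Xcube.
have [M [q [q0 q1 q_lt qP]]] := breakpoints (map snd hs).
pose p (_ : 'I_n) := q.
have p0 i : p i 0%N = 0 by [].
have p1 i : p i M.+2 = 1 by [].
have p_lt i b : (b < M.+2)%N -> p i b < p i b.+1 by move=> bM; exact: q_lt.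
have p_le i b : (b < M.+2)%N -> p i b <= p i b.+1 by move=> bM; exact/ltW/p_lt.
(* An open cell misses the boundary of X, so it is either contained in X or disjoint from it. *)
pose A : pred {ffun 'I_n -> 'I_M.+2} := fun k => `[< cell p k `<=` X >].
have bcell (k : {ffun 'I_n -> 'I_M.+2}) : boundary X `&` cell p k = set0.
  apply/seteqP; split => // x [/Xhs[[i c] /= hin xi] kx].
  have xi01 := cell_sub_unit_cube p0 p1 p_le kx i.
  have [|b bM cb] := qP c (map_f snd hin); first by rewrite -xi.
  have /andP[] := kx i; rewrite xi cb /p.
  have [bk|kb] := leqP b (k i).
    move: bk; rewrite leq_eqVlt => /orP[/eqP ->|bk]; first by rewrite ltxx.
    by rewrite ltNge ltW//; apply: q_lt => //; exact/ltnW/ltn_ord.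
  move=> _; rewrite ltNge; move: kb; rewrite leq_eqVlt => /orP[/eqP ->|kb]; first by rewrite lexx.
  by rewrite ltW//; exact: q_lt.
have XA : cell_structure p X A.
  move=> k x kx; split=> [Xx|/asboolP]; last exact.
  by apply/asboolP => y ky; exact: (obox_connected Xclosed (bcell k) kx ky Xx).
have VXA := Vol_cells p0 p1 p_le mX Xcube XA.
have ww := width_weights p0 p1 p_le.
have [w' [A' [ww' mA' rA' cA']]] := compress_all A ww.
(* Positive volume makes the family of kept cells nonempty; the corner condition rests on this. *)
have A'0 : exists k, A' k.
  apply: contrapT => A'0; move: VX; rewrite VXA -mA' /mass big1 ?ltxx// => k _.
  have [Ak|] := boolP (A' k); last by rewrite mulr0.
  by exfalso; apply: A'0; exists k.
exists (special_set w' A'); split; [|split].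
- apply: special_special_set => //.
  by move: VX; rewrite VXA mA' lte_fin lee_fin.
- by rewrite Vol_special_set// VXA mA'.
pose i0 := Ordinal n_gt0.
(* The normalizing factor of the Hausdorff measure is the same on both sides. *)
apply: lee_wpmul2l.
  by rewrite mule_ge0 ?Vol_ge0// lee_fin invr_ge0 exprn_ge0.
apply: le_trans (hausdorff_special_set n_gt0 ww' cA' i0) _.
apply: le_trans (relper_le_hausdorff n_gt0 p0 p1 p_lt mX XA i0).
by rewrite lee_fin ler_wpM2l ?kappa_ge0.
Qed.
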